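(* Fix some $0 < \varepsilon < 1$. Then, if $n_{g,\varepsilon}$ is the number of numerical semigroups $\Lambda$ of genus $g$ with $f(\Lambda) > (2+\varepsilon)m(\Lambda)$, we have $\limsup_{g \to \infty} n_{g,\varepsilon}^{1/g} < \varphi$.
   Context: A numerical semigroup $\Lambda$ is an additive submonoid of the nonnegative integers $\mathbb{N}_0$ with finite complement $\mathbb{N}_0 \setminus \Lambda$. Its genus is $g(\Lambda) = |\mathbb{N}_0 \setminus \Lambda|$, its multiplicity is $m(\Lambda) = \min(\Lambda \setminus \{0\})$, its conductor is $c(\Lambda) = \min\{c \in \mathbb{N}_0 : c + \mathbb{N}_0 \subseteq \Lambda\}$, and its Frobenius number is $f(\Lambda) = c(\Lambda) - 1$. Let $\varphi = \frac{1+\sqrt 5}{2}$. *)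

(* Defs.v *)
From mathcomp Require Import all_boot all_order all_algebra.
From mathcomp Require Import finmap.
From mathcomp Require Import all_classical all_reals all_analysis.

Set Implicit Arguments.
Unset Strict Implicit.
Unset Printing Implicit Defensive.

Import Order.TTheory GRing.Theory Num.Theory.

Local Open Scope classical_set_scope.
Local Open Scope ring_scope.

Definition numerical_semigroup (S : set nat) : Prop :=
  [/\ S 0%N, (forall x y, S x -> S y -> S (x + y)%N) & finite_set (~` S)].

(* Junk value 0 on the empty set; see [nat_minP]. *)
Definition nat_min (A : set nat) : nat :=
  xget 0%N [set n | A n /\ forall k, A k -> (n <= k)%N].

Definition genus (S : set nat) : nat := #|` fset_set (~` S)|.

Definition multiplicity (S : set nat) : nat := nat_min (S `\ 0%N).

Definition conductor (S : set nat) : nat :=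
  nat_min [set c | forall n, S (c + n)%N].

(* Integer-valued: the Frobenius number of the semigroup of all naturals
   is -1. *)
Definition frobenius (S : set nat) : int := (conductor S)%:Z - 1.

(* The cardinality [count_semigroups] is meaningful because this set is finite,
   see [finite_large_frobenius]. *)
Definition large_frobenius (R : realType) (eps : R) (g : nat) : set (set nat) :=
  [set S | [/\ numerical_semigroup S, genus S = g &
              (frobenius S)%:~R > (2 + eps) * (multiplicity S)%:R]].

Definition count_semigroups (R : realType) (eps : R) (g : nat) : nat :=
  #|` fset_set (large_frobenius eps g)|.

Definition golden_ratio (R : realType) : R := (1 + Num.sqrt 5) / 2.

Lemma nat_minP (A : set nat) : A !=set0 ->
  A (nat_min A) /\ forall k, A k -> (nat_min A <= k)%N.
Proof.
move=> [a Aa]; rewrite /nat_min.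
have exA : exists n, `[< A n >] by exists a; apply/asboolP.
case: (ex_minnP exA) => m /asboolP Am minm.
apply: (@xgetPex _ 0%N [set n | A n /\ forall k, A k -> (n <= k)%N]).
by exists m; split=> // k Ak; apply: minm; apply/asboolP.
Qed.

Lemma gap_bound (S : set nat) x :
  numerical_semigroup S -> ~ S x -> (x < (genus S).*2)%N.
Proof.
move=> [_ SD Sfin] Sx; pose G : seq nat := fset_set (~` S).
have GP i : ~ S i -> i \in G by move=> Si; rewrite /G in_fset_set// inE.
have sub : {subset iota 0 x.+1 <= G ++ [seq (x - i)%N | i <- G]}.
  move=> i; rewrite mem_iota mem_cat ltnS /= => ix.
  have [Si|/GP->//] := pselect (S i).
  apply/orP; right; apply/mapP; exists (x - i)%N; last by rewrite subKn.
  apply: GP => Sxi; apply: Sx.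
  by rewrite -(subnKC ix); exact: SD.
have := uniq_leq_size (iota_uniq 0 x.+1) sub.
by rewrite size_iota size_cat size_map addnn.
Qed.

Lemma finite_genus (g : nat) :
  finite_set [set S | numerical_semigroup S /\ genus S = g].
Proof.
pose F (A : {set 'I_g.*2}) : set nat :=
  [set n | (g.*2 <= n)%N \/ exists2 i, i \in A & n = val i].
apply: (@sub_finite_set _ _ (F @` setT)); last exact/finite_image/finite_finset.
move=> S [Sns gS]; exists [set i : 'I_g.*2 | `[< S i >]]%SET => //.
apply/seteqP; split=> n /=.
  move=> [gn|[i]]; last by rewrite inE => /asboolP Si ->.
  by apply: contrapT => /(gap_bound Sns); rewrite gS ltnNge gn.
move=> Sn; have [gn|ng] := leqP g.*2 n; [by left|right].
by exists (Ordinal ng) => //; rewrite inE; apply/asboolP.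
Qed.

Lemma finite_large_frobenius (R : realType) (eps : R) (g : nat) :
  finite_set (large_frobenius eps g).
Proof. by apply: sub_finite_set (finite_genus g) => S [? ? _]. Qed.

(* Main.v *)
Require Import Defs.
From mathcomp Require Import all_boot all_order all_algebra.
From mathcomp Require Import finmap zify ring lra.
From mathcomp Require Import all_classical all_reals all_analysis.

(** Let z = 1 / phi, so that z ^ 2 = 1 - z.  A numerical semigroup of
multiplicity m is determined by its Apery elements e_v = k_v m + v, where e_v
is the least positive element of the class v modulo m (so e_0 = m, k_0 = 1).
The labels k_v are positive, their sum is at most g + 1, and
e_(a+b) <= e_a + e_b for residues a, b.  Hence the number of semigroups of
genus g is at most phi ^ (g + 1) times the sum over m of the weights W_m, where
W_m sums the product of the z ^ k_v over all admissible label vectors k.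
Since z + z ^ 2 = 1, the label vectors with all k_v in {1, 2} together
contribute (z + z ^ 2) ^ m = 1 to W_m, which explains the growth rate phi.
The theorem follows once W_m is exponentially small in m for the vectors with
some e_i > (3 + eps) m: if m >= g / 20 this beats phi ^ g, and if m < g / 20
there are few compositions of g into m parts anyway (the crude estimate
[card_kunz_crude], which uses the weight 2 / 3 in place of z).

W_m is bounded by covering the admissible vectors by boxes, that is, products
of sets of labels: the weight of a box is a product of one-residue weights
([box_cover]).  Let Y be the set of the d largest Apery elements, d a small
fraction of m, and H the smallest of them.  All residues outside Y have
e_v < H, and for every y in Y the sumset constraint e_a + e_(y-a) >= H holds.
So if A is the set of residues with a small Apery element, no two elements of
A sum into Y.  The sum graph in which u and v are adjacent when u + v lies in Y
is d-regular, and independent sets of a regular graph of large degree are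
captured by few containers: A has a fingerprint F of boundedly many elements
such that A lies in a set D determined by F and Y, whose size hardly exceeds
that of the neighbourhood N of F ([fingerprint_exists], [card_container]).
Labels on N are forced to be large.  Pairing a residue of D with one of N, the
product of the two weights is less than 1, and residues outside both have
large labels as well; so each residue gains a constant factor
([container_bound]).  This is carried out, with suitable thresholds defining
A, for H >= 7 m ([deep_case]), 4 m <= H < 7 m ([middle_case]) and
3 m + s <= H < 4 m ([shallow_case]), where s is a small fraction of m; in the
last range only the residues below H - 3 m gain.

If H < 3 m + s, then all labels but a few are 1 or 2.  Here a single large
Apery element e_i is enough: the pairs of residues with sum i (or, when e_i
exceeds 4 m, the pairs with sum m + i) cannot both be labelled 1, so each pair
has weight 1 - z ^ 2 = z instead of 1.  There are linearly many such pairs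
precisely because e_i > (3 + eps) m ([matching_bound], [matching_case]).

All the losses (choices of Y and F, exceptional residues) are at most
a ^ (c m) with a as close to 1 as desired when d / m is small, whereas the
gain does not depend on d ([case_bound_decay]). *)

Set Implicit Arguments.
Unset Strict Implicit.
Unset Printing Implicit Defensive.

Import Order.TTheory GRing.Theory Num.Theory.

Local Open Scope ring_scope.

(** * Weighted sums over boxes *)

Lemma sum_cover (R : numDomainType) (I J : finType) (K : pred I) (P : pred J)
    (C : J -> pred I) (f : I -> R) :
  (forall i, 0 <= f i) ->
  (forall i, K i -> exists2 j, P j & C j i) ->
  \sum_(i | K i) f i <= \sum_(j | P j) \sum_(i | C j i) f i.
Proof.
move=> f0 Kcov; rewrite (exchange_big_dep xpredT)//=.
rewrite [leLHS]big_mkcond/=; apply: ler_sum => i _.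
have s0 : 0 <= \sum_(j | P j && C j i) f i by apply: sumr_ge0.
case: ifPn => // /Kcov[j Pj Cj].
by rewrite (bigD1 j) ?Pj//= lerDl sumr_ge0.
Qed.

(** The weight of one coordinate of a box; [N] truncates the labels, so that
all sums are finite, and no bound below depends on it. *)
Definition box_weight (R : pzSemiRingType) (z : R) (N : nat) (B : pred nat) : R :=
  \sum_(l < N | B l) z ^+ l.

Lemma box_weight_ge0 (R : numDomainType) (z : R) N B :
  0 <= z -> 0 <= box_weight z N B.
Proof. by move=> z0; apply: sumr_ge0 => i _; rewrite exprn_ge0. Qed.

(** Distributivity turns the sum over a box into a product over its
coordinates; overlaps of the boxes only help an upper bound. *)
Lemma box_cover (R : numDomainType) (V Th : finType) (N : nat)
    (K : pred {ffun V -> 'I_N}) (P : pred Th) (B : Th -> V -> pred nat) (z : R) :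
  0 <= z ->
  (forall k, K k -> exists2 t, P t & forall v, B t v (k v)) ->
  \sum_(k | K k) \prod_v z ^+ k v <= \sum_(t | P t) \prod_v box_weight z N (B t v).
Proof.
move=> z0 Kcov.
have -> : \sum_(t | P t) \prod_v box_weight z N (B t v) =
  \sum_(t | P t) \sum_(k in family (fun v (l : 'I_N) => B t v l)) \prod_v z ^+ k v.
  by apply: eq_bigr => t _; exact: (bigA_distr_big_dep (fun v => [pred l : 'I_N | B t v l])
    (fun v l => z ^+ nat_of_ord l)).
apply: sum_cover => [k|k /Kcov[t Pt Bt]].
  by apply: prodr_ge0 => v _; rewrite exprn_ge0.
by exists t => //; apply/familyP => v; exact: Bt.
Qed.

Lemma sum_subsets (R : comNzRingType) (V : finType) (P : {set V}) (z : R) :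
  \sum_(F : {set V} | F \subset P) z ^+ #|F| = (1 + z) ^+ #|P|.
Proof.
transitivity (\prod_(v : V) ((if v \in P then z else 0) + 1)).
  have -> : \prod_(v : V) ((if v \in P then z else 0) + 1) = \sum_(F : {set V})
      \prod_v (if v \in F then if v \in P then z else 0 else 1).
    exact: bigA_distr.
  rewrite [LHS]big_mkcond/=; apply: eq_big => // F _.
  case: ifPn => [FP|/fintype.subsetPn[v vF vP]].
    rewrite -prodr_const [LHS]big_mkcond/=; apply: eq_big => // v _.
    by case: ifPn => // /(fintype.subsetP FP)->.
  by rewrite (bigD1 v)//= vF (negbTE vP) mul0r.
rewrite -prodr_const [RHS]big_mkcond/=; apply: eq_big => // v _.
by case: ifP; rewrite ?add0r// addrC.
Qed.

Definition small_sets (V : finType) (d : nat) : {set {set V}} :=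
  [set F : {set V} | (#|F| <= d)%N]%SET.

(** Each set of at most [d] elements counts for at least [z ^+ d] in
[sum_subsets]: Chernoff's bound.  Taking [1 + z] close to 1, and [d] a
small fraction of [#|V|], makes the number of small sets subexponential. *)
Lemma card_small_sets (R : numFieldType) (V : finType) d (z : R) :
  0 < z <= 1 -> (#|small_sets V d|%:R : R) <= z ^- d * (1 + z) ^+ #|V|.
Proof.
move=> /andP[z0 z1]; rewrite mulrC ler_pdivlMr ?exprn_gt0//.
rewrite -cardsT -sum_subsets mulr_natl -sumr_const.
rewrite [leRHS](bigID (mem (small_sets V d)))/=.
apply: ler_wpDr; first by apply: sumr_ge0 => F _; rewrite exprn_ge0// ltW.
rewrite big_mkcond [leRHS]big_mkcond/=; apply: ler_sum => F _.
rewrite finset.subsetT/=; case: ifPn => //; rewrite inE => Fd.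
by rewrite ler_wiXn2l// ltW.
Qed.

(** * Containers in sum graphs *)

Section Fingerprint.
Variables (V : finZmodType) (P Y : {set V}) (L : nat).

(** The neighbourhood of [v] in the graph where [u] and [v] are adjacent when
[u + v] lies in [Y].  Loops are allowed, which makes the graph regular. *)
Definition sum_nbrs (v : V) : {set V} := [set u | u + v \in Y]%SET.

Definition nbrs_of (F : {set V}) : {set V} := (\bigcup_(a in F) sum_nbrs a)%SET.

(** The vertices all but a fraction [1 / L] of whose neighbours are already
neighbours of the fingerprint. *)
Definition container (F : {set V}) : {set V} :=
  [set v in P | L * #|sum_nbrs v :\: nbrs_of F| < #|Y|]%N%SET.

Lemma mem_nbrs_of (F : {set V}) u :
  reflect (exists2 a, a \in F & u + a \in Y) (u \in nbrs_of F).
Proof.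
by apply: (iffP finset.bigcupP) => -[a aF]; [rewrite inE => ?|move=> ?];
  exists a; rewrite ?inE.
Qed.

Lemma card_sum_nbrs v : #|sum_nbrs v| = #|Y|.
Proof.
have -> : sum_nbrs v = [set y - v | y in Y]%SET.
  apply/setP => u; rewrite inE; apply/idP/imsetP => [uY|[y yY ->]].
    by exists (u + v); rewrite ?addrK.
  by rewrite subrK.
by rewrite card_imset//; exact: addIr.
Qed.

(** Take [F] in [A] of largest size among the sets with neighbourhood of size at
least [#|F| * #|Y| / L].  A vertex of [A] outside the container would bring
at least [#|Y| / L] new neighbours, so it could be added to [F]. *)
Lemma fingerprint_exists (A : {set V}) : A \subset P -> (0 < #|Y|)%N ->
  exists F : {set V}, [/\ F \subset A, (#|F| * #|Y| <= L * #|nbrs_of F|)%N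
    & A \subset container F].
Proof.
move=> AP Y0.
pose good (F : {set V}) := (F \subset A) && (#|F| * #|Y| <= L * #|nbrs_of F|)%N.
have good0 : good finset.set0 by rewrite /good finset.sub0set cards0.
case: (arg_maxnP (fun F : {set V} => #|F|) good0) => F /andP[FA Fle] Fmax.
exists F; split=> //; apply/fintype.subsetP => v vA.
rewrite inE (fintype.subsetP AP)//=; rewrite ltnNge; apply/negP => le_Y.
have vF : v \notin F.
  apply/negP => vF; move: le_Y; rewrite (_ : _ :\: _ = finset.set0)%SET.
    by rewrite cards0 muln0 leqNgt Y0.
  apply/eqP; rewrite finset.setD_eq0; exact: (finset.bigcup_sup v).
have nbrsU : nbrs_of (v |: F)%SET = (nbrs_of F :|: (sum_nbrs v :\: nbrs_of F))%SET.
  rewrite /nbrs_of finset.bigcup_setU finset.big_set1 finset.setUC.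
  by apply/setP => u; rewrite !inE; case: (u \in \bigcup_(_ in _) _)%SET.
have : good (v |: F)%SET.
  rewrite /good finset.subUset finset.sub1set vA FA/= cardsU1 vF nbrsU cardsU.
  rewrite (_ : _ :&: _ = finset.set0)%SET ?cards0 ?subn0; last first.
    by apply/setP => u; rewrite !inE; case: (u \in nbrs_of F); rewrite ?andbF.
  by rewrite mulnDl mul1n mulnDr addnC leq_add.
by move=> /Fmax; rewrite cardsU1 vF/= add1n ltnn.
Qed.

(** Count the edges between the container and the neighbourhood of [F]: each
vertex of the former sends at least [(1 - 1 / L) * #|Y|] of them, each vertex
of the latter receives at most [#|Y|]. *)
Lemma card_container (F : {set V}) : (0 < #|Y|)%N ->
  (L.-1 * #|container F| <= L * #|nbrs_of F|)%N.
Proof.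
move=> Y0; rewrite -(leq_pmul2r Y0).
set N := nbrs_of F; set D := container F.
have double : (\sum_(v in D) #|sum_nbrs v :&: N| <= #|N| * #|Y|)%N.
  under eq_bigr do rewrite -sum1_card.
  rewrite (exchange_big_dep (mem N))/= => [|v u _]; last by rewrite inE => /andP[].
  rewrite -sum_nat_const; apply: leq_sum => u uN.
  rewrite sum1_card -(card_sum_nbrs u); apply/subset_leq_card/fintype.subsetP => v.
  by rewrite !inE unfold_in !inE uN andbT addrC => /andP[].
rewrite -!mulnA; apply: (@leq_trans (L * \sum_(v in D) #|sum_nbrs v :&: N|)%N); last first.
  by rewrite leq_mul2l double orbT.
rewrite mulnCA -sum_nat_const big_distrr/=; apply: leq_sum => v.
rewrite inE -/N => /andP[_ lt_Y].
have := cardsID N (sum_nbrs v); rewrite card_sum_nbrs => eqY.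
have : (L * #|sum_nbrs v :&: N| + L * #|sum_nbrs v :\: N| = L * #|Y|)%N.
  by rewrite -mulnDr eqY.
move: lt_Y; case: (L) => [|l]/=; lia.
Qed.

End Fingerprint.

Lemma prod_if_expr (R : comPzSemiRingType) (V : finType) (S : {set V}) (c : R) :
  \prod_v (if v \in S then c else 1) = c ^+ #|S|.
Proof. by rewrite -prodr_const [RHS]big_mkcond. Qed.

(** The boxes are indexed by pairs [(Y, F)].  The labels are restricted to
[BN] on the neighbourhood of the fingerprint [F], to [BD] on the rest of its
container, to [BO] elsewhere, and not at all on [Y].  The factor [beta] gained
by a neighbour pays for the one lost by a container vertex, and the container
exceeds the neighbourhood by at most [#|V| %/ L] vertices.  What remains is a
factor [gam] for each vertex of [P].  The constant 16 accounts for a vertex of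
[Y]: its weight is at most 4, and every vertex is otherwise allotted at least
[gam / beta >= 1 / 4]. *)
Lemma container_bound (R : realFieldType) (V : finZmodType) (N L d : nat)
    (P : {set V}) (z beta gam : R) (BD BN BO : V -> pred nat)
    (K : pred {ffun V -> 'I_N}) :
  0 <= z -> 1 <= beta <= 2 -> 1 / 2 <= gam <= 1 ->
  (0 < L)%N -> (0 < d)%N -> (L.+1 * #|V| <= d * d)%N ->
  box_weight z N xpredT <= 4 ->
  (forall v, v \in P -> box_weight z N (BD v) <= beta * gam) ->
  (forall v, box_weight z N (BN v) <= (if v \in P then gam else 1) / beta) ->
  (forall v, box_weight z N (BO v) <= (if v \in P then gam else 1)) ->
  (forall k : {ffun V -> 'I_N}, K k -> exists Y A : {set V},
    [/\ #|Y| = d, A \subset P,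
        forall v, v \notin Y -> v \in P -> BD v (k v),
        forall v, v \notin Y -> v \notin A -> BO v (k v) &
        forall v a, v \notin Y -> a \in A -> v + a \in Y -> BN v (k v)]) ->
  \sum_(k | K k) \prod_v z ^+ k v <=
    #|small_sets V d|%:R ^+ 2 * (16 ^+ d * beta ^+ (#|V| %/ L) * gam ^+ #|P|).
Proof.
move=> z0 /andP[b1 b2] /andP[g1 g2] L0 d0 Ld W4 WD WN WO Kcov.
have bgt0 : 0 < beta by lra.
have ggt0 : 0 < gam by lra.
pose box (t : {set V} * {set V}) (v : V) : pred nat :=
  if v \in t.1 then xpredT else if v \in nbrs_of t.1 t.2 then BN v
  else if v \in container P t.1 L.+1 t.2 then BD v else BO v.
pose Th (t : {set V} * {set V}) := (#|t.1| == d) && (#|t.2| <= d)%N.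
have cover k : K k -> exists2 t, Th t & forall v, box t v (k v).
  move=> /Kcov[Y [A [Yd AP hD hO hN]]].
  have [|F [FA Fle AC]] := @fingerprint_exists _ P Y L.+1 A AP.
    by rewrite Yd.
  exists (Y, F) => [|v]; rewrite /Th/box/=.
    rewrite Yd eqxx/= -(leq_pmul2r d0) -Yd.
    by rewrite (leq_trans Fle)// Yd (leq_trans _ Ld)// leq_mul2l max_card orbT.
  case: ifPn => // vY; case: (boolP (v \in nbrs_of Y F)) => [/mem_nbrs_of[a aF vaY]|_].
    exact: (hN v a vY (fintype.subsetP FA a aF) vaY).
  case: ifPn => [|vC]; first by rewrite inE => /andP[vP _]; exact: hD.
  by apply: hO => //; apply: contra vC; exact: (fintype.subsetP AC).
apply: (le_trans (box_cover z0 cover)).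
have boxle t : Th t -> \prod_v box_weight z N (box t v) <=
    16 ^+ d * beta ^+ (#|V| %/ L) * gam ^+ #|P|.
  case: t => Y F /andP[/= /eqP Yd _].
  set NF := nbrs_of Y F; set C := container P Y L.+1 F.
  have CN : (#|C :\: NF| <= #|NF| + #|V| %/ L)%N%SET.
    have := @card_container _ P Y L.+1 F; rewrite Yd => /(_ d0)/= leC.
    apply: (leq_trans (subset_leq_card (finset.subsetDl _ _))).
    rewrite -leq_subLR leq_divRL// mulnC mulnBr.
    have leV : (#|NF| <= #|V|)%N by exact: max_card.
    by move: leC; rewrite -/C -/NF mulSn leq_subLR => /leq_trans; apply; rewrite addnC leq_add2l.
  apply: (@le_trans _ _ (\prod_v ((if v \in Y then 16 else 1) *
      ((if v \in P then gam else 1) *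
      ((if v \in NF then beta^-1 else 1) * (if v \in C :\: NF then beta else 1)))))%SET).
    apply: ler_prod => v _; rewrite box_weight_ge0//= /box/= -/NF -/C finset.in_setD.
    have gv : 1 / 2 <= (if v \in P then gam else 1) <= 1 by case: ifP; lra.
    have ib : 1 / 2 <= beta^-1.
      by rewrite mul1r lef_pV2 ?posrE.
    case: ifPn => vY; last rewrite mul1r.
      apply: (le_trans W4); case/andP: gv => gv _.
      have ic : 1 / 2 <= (if v \in NF then beta^-1 else 1) *
          (if (v \notin NF) && (v \in C) then beta else 1).
        by case: (v \in NF); case: (v \in C) => /=; rewrite ?mulr1 ?mul1r; lra.
      have : 1 / 2 * (1 / 2) <= (if v \in P then gam else 1) *
         ((if v \in NF then beta^-1 else 1) *
          (if (v \notin NF) && (v \in C) then beta else 1)).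
        by apply: ler_pM => //; lra.
      by move=> h; rewrite -[4]/(4%:R) (_ : 4 = 16 * (1 / 2 * (1 / 2)) :> R); [rewrite ler_pM2l|lra].
    case: (boolP (v \in NF)) => /= vN; first by rewrite mulr1; exact: WN.
    rewrite mul1r; case: ifPn => [|vC]; last by rewrite mulr1; exact: WO.
    rewrite inE => /andP[vP _]; rewrite vP mulrC; exact: WD.
  rewrite 3!big_split/= !prod_if_expr Yd -mulrA ler_wpM2l ?exprn_ge0//.
  rewrite mulrC ler_wpM2r ?exprn_ge0 ?(ltW ggt0)// exprVn ler_pdivrMl ?exprn_gt0//.
  by rewrite -exprD ler_weXn2l.
apply: (le_trans (ler_sum _ boxle)); rewrite sumr_const -[leLHS]mulr_natl.
apply: ler_wpM2r; first by rewrite !mulr_ge0 ?exprn_ge0 ?(ltW bgt0) ?(ltW ggt0).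
rewrite -natrX ler_nat expnS expn1 -cardsX.
apply/subset_leq_card/fintype.subsetP => -[Y F].
by rewrite unfold_in /Th/= => /andP[/eqP Yd Fd]; rewrite !inE/= Yd leqnn.
Qed.

(** * Weights of labels and the matching bound *)

Lemma box_weight_seq (R : numDomainType) (z : R) N (B : pred nat) (s : seq nat) :
  0 <= z -> (forall l, B l -> l \in s) ->
  box_weight z N B <= \sum_(l <- s) z ^+ l.
Proof.
move=> z0 Bs.
apply: (@le_trans _ _ (\sum_(l < N) \sum_(j <- s | j == l) z ^+ j)).
  rewrite /box_weight big_mkcond/=; apply: ler_sum => l _.
  case: ifPn => [/Bs ls|_]; last by apply: sumr_ge0 => j _; exact: exprn_ge0.
  rewrite (perm_big _ (perm_to_rem ls))/= big_cons eqxx lerDl.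
  by apply: sumr_ge0 => j _; exact: exprn_ge0.
rewrite (exchange_big_dep xpredT)//=; apply: ler_sum => j _.
case: (ltnP j N) => jN.
  by rewrite (big_pred1 (Ordinal jN))// => i; rewrite /= eq_sym -val_eqE.
rewrite big1 ?exprn_ge0// => i /eqP ji; move: (ltn_ord i); rewrite -ji; lia.
Qed.

(** The full geometric tail [z ^+ p / (1 - z)], since [1 - z = z ^+ 2]. *)
Lemma box_weight_tail (R : realFieldType) (z : R) N (B : pred nat) p :
  0 < z -> z ^+ 2 = 1 - z -> (forall l, B l -> (p <= l)%N) ->
  box_weight z N B <= z ^+ p / z ^+ 2.
Proof.
move=> z0 z2 Bp; rewrite ler_pdivlMr ?exprn_gt0//.
suff: box_weight z N B * z ^+ 2 <= z ^+ p - z ^+ maxn p N.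
  by move/le_trans; apply; rewrite gerBl exprn_ge0// ltW.
elim: N => [|N IH].
  by rewrite /box_weight big_ord0 mul0r maxn0 subrr.
move: IH; rewrite /box_weight [in X in _ -> X]big_mkcond big_ord_recr/= -big_mkcond/=.
rewrite mulrDl; set S := \sum_(_ < N | _) _ => IH.
case: ifPn => [/Bp pN|_].
  move: IH; rewrite (maxn_idPr pN) (maxn_idPr (leqW pN)) z2 exprSr; lra.
have z1 : z <= 1 by have : 0 < z ^+ 2 by [rewrite exprn_gt0]; lra.
by rewrite mul0r addr0 (le_trans IH)// lerB// ler_wiXn2l ?(ltW z0)//; lia.
Qed.

(** Outside a small set all labels are 1 or 2, and two residues with sum [t]
are not both labelled 1.  A box is given by the exceptional set and by the set
[F] of residues labelled 1 in the window [lo <= v < lo + p]; the mates [t - v]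
of the residues [v] of [F] then have label 2.  A pair thus weighs
[z * z ^+ 2 + z ^+ 2 * 1 = z] in total, whence the factor [z ^+ p].  The
hypothesis on the window says that mates are residues and lie outside it. *)
Lemma matching_bound (R : realFieldType) (n N d lo p t : nat) (Z : {set 'I_n})
    (z : R) (K : pred {ffun 'I_n -> 'I_N}) :
  1 / 2 <= z -> z ^+ 2 = 1 - z -> box_weight z N xpredT <= 4 ->
  (lo + p <= n)%N ->
  (forall v, (lo <= v < lo + p)%N -> (v.*2 < t)%N /\ (t < v + n)%N) ->
  (forall k : {ffun 'I_n -> 'I_N}, K k ->
    exists2 Y : {set 'I_n}, (#|Y| <= d)%N &
      (forall v, v \notin Y :|: Z -> (0 < k v <= 2)%N)%SET /\
      (forall u v : 'I_n, (u + v)%N = t -> (2 < k u + k v)%N)) ->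
  \sum_(k | K k) \prod_v z ^+ k v <=
    #|small_sets 'I_n d|%:R * (16 ^+ (d + #|Z|) * z ^+ p).
Proof.
move=> z12 z2 W4 lop ht Kcov.
have z0 : 0 < z by lra.
have z1 : z <= 1 by have : 0 < z ^+ 2 by [rewrite exprn_gt0]; lra.
pose P0 := [set v : 'I_n | (lo <= v < lo + p)%N]%SET.
pose mate (F : {set 'I_n}) := [set v : 'I_n | [exists u in F, (u + v == t)%N]]%SET.
have cP0 : #|P0| = p.
  have -> : P0 = [set widen_ord lop (rshift lo i) | i in 'I_p]%SET.
    apply/setP => v; rewrite inE; apply/idP/imsetP => [/andP[lv vp]|[i _ ->/=]].
      have vl : (v - lo < p)%N by lia.
      by exists (Ordinal vl) => //; apply/val_inj => /=; lia.
    by have := ltn_ord i; lia.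
  rewrite card_imset ?card_ord// => i j /(congr1 val)/= /addnI; exact: val_inj.
have mateP (F : {set 'I_n}) : F \subset P0 -> (#|F| <= #|mate F|)%N.
  move=> FP.
  have tv (v : 'I_n) : v \in F -> (v <= t)%N /\ (t - v < n)%N.
    by move=> /(fintype.subsetP FP); rewrite inE => /ht; lia.
  rewrite -(@card_in_imset _ _ (fun v : 'I_n => insubd v (t - v)%N) (mem F)).
    apply/subset_leq_card/fintype.subsetP => u /imsetP[v vF ->].
    rewrite inE; apply/existsP; exists v; rewrite vF/= val_insubd.
    by have [vt tn] := tv v vF; rewrite tn subnKC.
  move=> u v uF vF /(congr1 val); rewrite !val_insubd.
  have [ut ->] := tv u uF; have [vt ->] := tv v vF => e.
  by apply/val_inj => /=; lia.
have mate_disj (F : {set 'I_n}) v : F \subset P0 -> v \in mate F -> v \notin P0.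
  move=> FP; rewrite inE => /existsP[u /andP[uF /eqP uvt]].
  have := fintype.subsetP FP u uF; rewrite !inE => /ht[uu _].
  by apply/negP => /ht[vv _]; lia.
pose box (r : {set 'I_n} * {set 'I_n}) (v : 'I_n) : pred nat :=
  if (v \in r.1 :|: Z)%SET then xpredT else
  if v \in r.2 then pred1 1%N else
  if (v \in P0) || (v \in mate r.2) then pred1 2%N else [pred l | 0 < l <= 2]%N.
pose Th (r : {set 'I_n} * {set 'I_n}) := (r.1 \in small_sets 'I_n d) && (r.2 \subset P0).
have cover k : K k -> exists2 r, Th r & forall v, box r v (k v).
  move=> /Kcov[Y Yd [k12 k3]]; exists (Y, [set v in P0 | k v == 1%N :> nat]%SET).
    by rewrite /Th inE Yd/=; apply/fintype.subsetP => v; rewrite inE => /andP[].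
  move=> v; rewrite /box /=; case: ifPn => // /k12 kv.
  case: ifPn => [|vF]; first by rewrite inE => /andP[].
  case: ifPn => // /orP[vP|]; first by move: vF; rewrite inE vP/=; lia.
  rewrite inE => /existsP[u /andP[]]; rewrite inE => /andP[_ /eqP ku] /eqP uv.
  by have := k3 _ _ uv; rewrite ku/=; lia.
apply: (le_trans (box_cover (ltW z0) cover)).
have w1 c : box_weight z N (pred1 c) <= z ^+ c.
  apply: (le_trans (@box_weight_seq _ z N (pred1 c) [:: c] (ltW z0) _)).
    by move=> l /eqP ->; rewrite mem_head.
  by rewrite big_seq1.
have w12 : box_weight z N [pred l | 0 < l <= 2]%N <= 1.
  apply: (le_trans (@box_weight_seq _ z N _ [:: 1; 2]%N (ltW z0) _)).
    by move=> l; rewrite !inE /=; lia.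
  by rewrite big_cons big_seq1 expr1 z2; lra.
have boxle r : Th r -> \prod_v box_weight z N (box r v) <=
    16 ^+ (d + #|Z|) * (z ^+ 2 ^+ p * z ^+ #|r.2|).
  case: r => Y F; rewrite /Th inE/= => /andP[Yd FP].
  apply: (@le_trans _ _ (\prod_v ((if v \in Y :|: Z then 16 else 1) *
      ((if v \in F then z else 1) * ((if v \in P0 :\: F then z ^+ 2 else 1) *
      (if v \in mate F then z ^+ 2 else 1)))))%SET).
    apply: ler_prod => v _; rewrite box_weight_ge0 ?(ltW z0)//= /box/=.
    rewrite (finset.in_setD P0).
    have z20 : 0 < z ^+ 2 <= 1 by rewrite exprn_gt0//=; lra.
    have z4 : 1 / 4 <= z ^+ 2.
      by rewrite (_ : 1 / 4 = (1 / 2) ^+ 2) ?lerXn2r ?nnegrE//; lra.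
    have := @mate_disj F v FP; have := fintype.subsetP FP v.
    case: (v \in F) => [/(_ isT)->|_].
      case: (v \in mate F) => [/(_ isT)//|_] /=; rewrite !mulr1.
      case: ifP => _; first by apply: (le_trans W4); lra.
      by rewrite mul1r; exact: w1.
    case: (v \in P0) => /=; [move=> H|move=> _].
      have -> : (v \in mate F) = false by apply/negP => /H.
      rewrite mulr1 mul1r; case: ifP => _; first by apply: (le_trans W4); lra.
      by rewrite mul1r; exact: w1.
    rewrite !mul1r; case: (v \in mate F).
      case: ifP => _; first by apply: (le_trans W4); lra.
      by rewrite mul1r; exact: w1.
    case: ifP => _; first by apply: (le_trans W4); lra.
    by rewrite mul1r; exact: w12.
  rewrite 3!big_split/= !prod_if_expr; apply: ler_pM.
  - by rewrite exprn_ge0.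
  - by rewrite !mulr_ge0 ?exprn_ge0// ltW.
  - rewrite ler_weXn2l ?ler1n// cardsU (leq_trans (leq_subr _ _))// leq_add2r//.
  rewrite [leLHS]mulrC ler_wpM2r ?exprn_ge0 ?(ltW z0)//.
   have z21 : z ^+ 2 <= 1 by lra.
  rewrite -exprD ler_wiXn2l ?exprn_ge0 ?(ltW z0)//.
  have Fp : (#|F| <= p)%N by rewrite -cP0 subset_leq_card.
  rewrite cardsD (finset.setIidPr FP) cP0.
  by rewrite -leq_subLR subKn// mateP.
apply: (le_trans (ler_sum _ boxle)).
rewrite -big_distrr/= -[leLHS]mulrC.
rewrite -(pair_big (mem (small_sets 'I_n d)) (fun F : {set 'I_n} => F \subset P0)
  (fun _ F => z ^+ 2 ^+ p * z ^+ #|F|))/=.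
rewrite sumr_const -big_distrr/= sum_subsets cP0 -exprMn.
have -> : z ^+ 2 * (1 + z) = z by rewrite z2 -subr_sqr expr1n z2; lra.
by rewrite mulrC mulrnAr mulr_natl.
Qed.

(** * Kunz vectors of large Frobenius number *)

Definition apery n N (k : {ffun 'I_n.+1 -> 'I_N}) (v : 'I_n.+1) : nat :=
  (k v * n.+1 + v)%N.

(** Addition of residues is modulo [n.+1].  For a semigroup, the class 0 is
represented by the multiplicity, so that its label is 1 rather than 0. *)
Definition kunz n N (k : {ffun 'I_n.+1 -> 'I_N}) : Prop :=
  (forall v, 0 < k v)%N /\
  (forall a b, apery k (a + b)%R <= apery k a + apery k b)%N.

Definition tall n N (k : {ffun 'I_n.+1 -> 'I_N}) (H : nat) : {set 'I_n.+1} :=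
  [set v | H <= apery k v]%N%SET.

Lemma apery_inj n N (k : {ffun 'I_n.+1 -> 'I_N}) : injective (apery k).
Proof.
move=> u v /(congr1 (modn^~ n.+1)); rewrite /apery !modnMDl !modn_small//.
exact: val_inj.
Qed.

(** Apery elements are distinct, so the number of those above a threshold drops
by at most one when the threshold increases by one. *)
Lemma exists_tall_of_card n N (k : {ffun 'I_n.+1 -> 'I_N}) d : (0 < d <= n.+1)%N ->
  exists H, #|tall k H| = d.
Proof.
move=> /andP[d0 dn].
have tall0 : (d <= #|tall k 0|)%N.
  by rewrite (_ : tall k 0 = [set: 'I_n.+1]%SET) ?cardsT ?card_ord//; apply/setP => v; rewrite !inE.
have bnd H : (d <= #|tall k H|)%N -> (H <= \max_v apery k v)%N.
  move=> dH; have /card_gt0P[v] : (0 < #|tall k H|)%N by lia.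
  by rewrite inE => /leq_trans; apply; exact: leq_bigmax.
case: (@ex_maxnP (fun H => d <= #|tall k H|)%N _ (ex_intro _ 0%N tall0) bnd) => H dH Hmax; exists H.
apply/eqP; rewrite eqn_leq dH andbT.
have lt_d : (#|tall k H.+1| < d)%N by rewrite ltnNge; apply/negP => /Hmax; rewrite ltnn.
rewrite (leq_trans _ lt_d)//.
have [v Hv|noH] := pickP [pred v | apery k v == H]; last first.
  apply: leqW; apply/subset_leq_card/fintype.subsetP => v; rewrite !inE.
  by rewrite leq_eqVlt eq_sym => /orP[|//]; have /= -> := noH v.
rewrite -(addn1 #|tall k H.+1|) -(cards1 v) (leq_trans _ (leq_card_setU _ _))//.
apply/subset_leq_card/fintype.subsetP => u; rewrite !inE leq_eqVlt => /orP[/eqP Hu|->//].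
by rewrite -(inj_eq (@apery_inj _ _ k)) (eqP Hv) Hu eqxx orbT.
Qed.

Lemma card_below n r : (r <= n)%N -> #|[set v : 'I_n | v < r]%N%SET| = r.
Proof.
move=> rn; rewrite -sum1_card (eq_bigl (fun v : 'I_n => v < r)%N) => [|v].
  by rewrite -(big_ord_widen _ (fun=> 1%N) rn) sum1_card card_ord.
by rewrite inE.
Qed.

Definition inv_golden (R : realFieldType) (z : R) : Prop :=
  0 < z /\ z ^+ 2 = 1 - z.

Lemma inv_golden_bounds (R : realFieldType) (z : R) : inv_golden z ->
  [/\ 3 / 5 < z, z < 5 / 8, 0 < z & z ^+ 2 = 1 - z].
Proof.
move=> [z0 z2]; split=> //; rewrite ltNge; apply/negP => h.
  have : z ^+ 2 <= (3 / 5) ^+ 2 by rewrite lerXn2r ?nnegrE//; lra.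
  by rewrite z2; lra.
have : (5 / 8) ^+ 2 <= z ^+ 2 by rewrite lerXn2r ?nnegrE//; lra.
by rewrite z2; lra.
Qed.

(** A factor that every case below can afford to gain on each residue.  The
critical one is [middle_case], where labels are at most 6: there the
truncation of the labels is what saves the estimate, and the weight cut off is
a small power of [z]. *)
Definition gain (R : pzRingType) (z : R) : R := 1 - z ^+ 8.

Section Golden.
Variables (R : realFieldType) (z : R).
Hypothesis gz : inv_golden z.

Lemma gain_bounds : 19 / 20 <= gain z < 1.
Proof.
have [zl zh z0 z2] := inv_golden_bounds gz.
rewrite /gain; have z8 : 0 < z ^+ 8 by rewrite exprn_gt0.
have z4 : z ^+ 4 <= 4 / 25.
  rewrite -[4%N]/(2 * 2)%N exprM z2 (_ : 4 / 25 = (2 / 5) ^+ 2); last by lra.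
  by rewrite lerXn2r ?nnegrE//; lra.
have : z ^+ 8 <= (4 / 25) ^+ 2.
  by rewrite -[8%N]/(4 * 2)%N exprM lerXn2r ?nnegrE ?exprn_ge0 ?(ltW z0)//; lra.
lra.
Qed.

Lemma all_weight N : box_weight z N xpredT <= 4.
Proof.
have [zl zh z0 z2] := inv_golden_bounds gz.
apply: (le_trans (@box_weight_tail _ z N xpredT 0 z0 z2 _)) => //.
rewrite expr0 ler_pdivrMr ?exprn_gt0// z2; lra.
Qed.

Lemma tail_weight N p : box_weight z N [pred l | p.+2 <= l]%N <= z ^+ p.
Proof.
have [zl zh z0 z2] := inv_golden_bounds gz.
apply: (le_trans (@box_weight_tail _ z N _ p.+2 z0 z2 _)) => //.
by rewrite -addn2 exprD mulfK// gt_eqF// exprn_gt0.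
Qed.

Lemma positive_weight N : box_weight z N [pred l | 0 < l]%N <= 1 + z.
Proof.
have [zl zh z0 z2] := inv_golden_bounds gz.
apply: (le_trans (@box_weight_tail _ z N _ 1 z0 z2 _)) => //.
by rewrite ler_pdivrMr ?exprn_gt0// z2 expr1 mulrC -subr_sqr expr1n z2; lra.
Qed.

Lemma range_weight N a b :
  box_weight z N [pred l | a <= l < b]%N <= \sum_(l <- index_iota a b) z ^+ l.
Proof.
have [zl zh z0 z2] := inv_golden_bounds gz.
apply: box_weight_seq; first exact: ltW.
by move=> l; rewrite mem_index_iota.
Qed.

Variables (n N d L s : nat).
Implicit Type k : {ffun 'I_n.+1 -> 'I_N}.

Hypotheses (L0 : (0 < L)%N) (d0 : (0 < d)%N) (Ld : (L.+1 * n.+1 <= d * d)%N).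

(** The shape common to all four cases: two small sets are chosen, [16 ^+ d] and
[2 ^+ (n.+1 %/ L)] are the losses in [container_bound], and at least [s]
residues gain. *)
Definition case_bound : R :=
  #|small_sets 'I_n.+1 d|%:R ^+ 2 * (16 ^+ d * 2 ^+ (n.+1 %/ L) * gain z ^+ s).

Lemma weaken_case (beta : R) p : 1 <= beta <= 2 -> (s <= p)%N ->
  #|small_sets 'I_n.+1 d|%:R ^+ 2 * (16 ^+ d * beta ^+ (n.+1 %/ L) * gain z ^+ p)
  <= case_bound.
Proof.
move=> /andP[b1 b2] sp; have /andP[g0 g1] := gain_bounds.
rewrite ler_wpM2l ?exprn_ge0// ler_pM ?mulr_ge0 ?exprn_ge0//; try lra.
  by rewrite ler_wpM2l ?exprn_ge0// lerXn2r ?nnegrE; lra.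
by rewrite ler_wiXn2l//; lra.
Qed.

(** [A] is the set of residues labelled 1 or 2; neighbours have label at least
4 and other residues have label at least 3.  With [beta = 2]: [1 + z <= 2 * gain],
[z ^+ 2 <= gain / 2] and [z <= gain]. *)
Lemma deep_case (K : pred {ffun 'I_n.+1 -> 'I_N}) : (s <= n.+1)%N ->
  (forall k, K k -> kunz k /\ exists2 H, #|tall k H| = d & (7 * n.+1 <= H)%N) ->
  \sum_(k | K k) \prod_v z ^+ k v <= case_bound.
Proof.
move=> sm hK; have [zl zh z0 z2] := inv_golden_bounds gz.
have /andP[g0 g1] := gain_bounds.
apply: (le_trans (@container_bound _ _ N L d [set: 'I_n.+1]%SET z 2 (gain z)
  (fun=> [pred l | 0 < l]%N) (fun=> [pred l | 4 <= l]%N) (fun=> [pred l | 3 <= l]%N)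
  K _ _ _ _ _ _ _ _ _ _ _)) => //.
- exact: ltW.
- by lra.
- by lra.
- by rewrite card_ord.
- exact: all_weight.
- by move=> v _; apply: (le_trans (positive_weight N)); lra.
- move=> v; rewrite inE; apply: (le_trans (tail_weight N 2)).
  by rewrite ler_pdivlMr; lra.
- by move=> v; rewrite inE; apply: (le_trans (tail_weight N 1)); rewrite expr1; lra.
- move=> k /hK[[k0 ksub] [H Hd H7]]; exists (tall k H), [set v | k v <= 2]%N%SET.
  split=> //.
  + by move=> v _ _ /=.
  + by move=> v _; rewrite inE -ltnNge.
  + move=> v a _; rewrite !inE /= => ka Hva.
    have := leq_trans H7 (leq_trans Hva (ksub v a)); rewrite /apery => va.
    rewrite ltnNge; apply/negP => kv.
    have : (k v * n.+1 <= 3 * n.+1)%N by rewrite leq_mul2r kv orbT.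
    have : (k a * n.+1 <= 2 * n.+1)%N by rewrite leq_mul2r ka orbT.
    move: va (ltn_ord a) (ltn_ord v).
    by move: (k v * n.+1)%N (k a * n.+1)%N (nat_of_ord a) (nat_of_ord v); lia.
by rewrite card_ord cardsT card_ord weaken_case//; lra.
Qed.


(** [A] is the set of residues labelled 1.  A neighbour satisfies
[H - 2 m < e_v < H], which leaves two consecutive labels, both at least 2, of
total weight at most [z ^+ 2 + z ^+ 3 = z].  As the labels of the container
may weigh almost [1 + z = z^-1], the product is below 1 only thanks to the
bound 6 on labels; [beta = (1 + z) * gain] splits the slack evenly. *)
Lemma middle_case (K : pred {ffun 'I_n.+1 -> 'I_N}) H : (s <= n.+1)%N ->
  (4 * n.+1 <= H < 7 * n.+1)%N ->
  (forall k, K k -> kunz k /\ #|tall k H| = d) ->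
  \sum_(k | K k) \prod_v z ^+ k v <= case_bound.
Proof.
move=> sm /andP[H4 H7] hK.
have [zl zh z0 z2] := inv_golden_bounds gz; have /andP[g0 g1] := gain_bounds.
pose c (v : 'I_n.+1) := ((H - 2 * n.+1 - v) %/ n.+1).+1.
(* Powers of z are linear in z, with Fibonacci coefficients. *)
have z3 : z ^+ 3 = 2 * z - 1 by rewrite exprS z2 mulrBr -expr2 z2; lra.
have z4 : z ^+ 4 = 2 - 3 * z by rewrite exprS z3 mulrBr mulrCA -expr2 z2; lra.
have z5 : z ^+ 5 = 5 * z - 3 by rewrite exprS z4 mulrBr mulrCA -expr2 z2; lra.
have z6 : z ^+ 6 = 5 - 8 * z by rewrite exprS z5 mulrBr mulrCA -expr2 z2; lra.
have z7 : z ^+ 7 = 13 * z - 8 by rewrite exprS z6 mulrBr mulrCA -expr2 z2; lra.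
have z8 : z ^+ 8 = 13 - 21 * z by rewrite exprS z7 mulrBr mulrCA -expr2 z2; lra.
(* z ^ 13 = 233 z - 144 is positive; 3 / 5 is too weak a lower bound for z below. *)
have z13 : 144 < 233 * z.
  have : 0 < z ^+ 8 * z ^+ 5 by rewrite mulr_gt0 ?exprn_gt0.
  rewrite z8 z5.
  have -> : (13 - 21 * z) * (5 * z - 3) = 128 * z - 105 * z ^+ 2 - 39 by ring.
  by rewrite z2; lra.
have zinv : 1 / (1 + z) = z.
  apply: (canLR (mulfK _)); first by lra.
  by rewrite mulrDr mulr1 -expr2 z2; lra.
pose beta := (1 + z) * gain z.
have b12 : 1 <= beta <= 2.
  rewrite /beta /gain z8 (_ : (1 + z) * _ = 21 * z ^+ 2 + 9 * z - 12); last by ring.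
  by rewrite z2; lra.
apply: (le_trans (@container_bound _ _ N L d [set: 'I_n.+1]%SET z beta (gain z)
  (fun=> [pred l | 1 <= l < 7]%N) (fun v => [pred l | c v <= l < (c v).+2]%N)
  (fun=> [pred l | 2 <= l < 7]%N)
  K _ _ _ _ _ _ _ _ _ _ _)) => //.
- exact: ltW.
- by lra.
- by rewrite card_ord.
- exact: all_weight.
- move=> v _; apply: (le_trans (range_weight _ _ _)).
  rewrite !big_cons big_nil expr1 z2 z3 z4 z5 z6 /beta /gain z8.
  rewrite (_ : (1 + z) * _ * _ = 441 * (z * z ^+ 2) - 63 * z ^+ 2 - 360 * z + 144); last by ring.
  by rewrite -exprS z3 z2; lra.
- move=> v; rewrite inE; apply: (le_trans (range_weight _ _ _)).
  rewrite /index_iota subSn// subSnn /= big_cons big_seq1.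
  have c2 : (2 <= c v)%N by rewrite ltnS divn_gt0//; have := ltn_ord v; lia.
  have -> : gain z / beta = z ^+ 2 + z ^+ 3.
    rewrite /beta invfM mulrCA divff ?mulr1; last by lra.
    by rewrite -[LHS]mul1r zinv z2 z3; lra.
  by apply: lerD; rewrite ler_wiXn2l//; lra.
- move=> v; rewrite inE; apply: (le_trans (range_weight _ _ _)).
  rewrite !big_cons big_nil z2 z3 z4 z5 z6 /gain z8.
  by lra.
- move=> k /hK[[k0 ksub] Hd]; exists (tall k H), [set v | k v <= 1]%N%SET.
  have cap v : v \notin tall k H -> (k v <= 6)%N.
    rewrite inE -ltnNge /apery => vH; rewrite leqNgt; apply/negP => k7.
    have : (7 * n.+1 <= k v * n.+1)%N by rewrite leq_mul2r k7 orbT.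
    by move: vH; move: (k v * n.+1)%N; lia.
  split=> //.
  + by move=> v vH _; rewrite /= k0 ltnS cap.
  + by move=> v vH; rewrite !inE -ltnNge /= ltnS cap// => ->.
  + move=> v a; rewrite !inE -ltnNge => vH ka Hva.
    have := leq_trans Hva (ksub v a); rewrite /apery in vH * => va.
    have ka1 : (k a * n.+1 <= n.+1)%N by rewrite -[leqRHS]mul1n leq_mul2r ka orbT.
    have vm := ltn_ord v; rewrite /= /c ltn_divLR// ltnS.
    rewrite -[X in _ && X]/(_ <= 2 + _)%N -leq_subLR leq_divRL// mulnBl.
    move: va vH ka1 vm (ltn_ord a); move: (k v * n.+1)%N (k a * n.+1)%N.
    by move: (nat_of_ord v) (nat_of_ord a); lia.
by rewrite card_ord cardsT card_ord weaken_case//; lra.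
Qed.

(** Here [H = 3 m + r], and [A] consists of the residues below [r] labelled 1:
for these [e_a < m + r], hence [e_b > 2 m] for every neighbour [b].  Labels are at most 3 below [r] and
at most 2 from [r] on.  With [beta = 7 / 5], the container weighs
[z + z ^+ 2 + z ^+ 3 = 2 z] and the neighbours at most [z] or [z ^+ 2]. *)
Lemma shallow_case (K : pred {ffun 'I_n.+1 -> 'I_N}) r : (s <= r < n.+1)%N ->
  (forall k, K k -> kunz k /\ #|tall k (3 * n.+1 + r)| = d) ->
  \sum_(k | K k) \prod_v z ^+ k v <= case_bound.
Proof.
move=> /andP[sr rn] hK.
have [zl zh z0 z2] := inv_golden_bounds gz; have /andP[g0 g1] := gain_bounds.
have z3 : z ^+ 3 = 2 * z - 1 by rewrite exprS z2 mulrBr -expr2 z2; lra.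
pose P := [set v : 'I_n.+1 | v < r]%N%SET.
have cP : #|P| = r by exact/card_below/ltnW.
apply: (le_trans (@container_bound _ _ N L d P z (7 / 5) (gain z)
  (fun=> [pred l | 1 <= l < 4]%N)
  (fun v : 'I_n.+1 => if (v < r)%N then [pred l | 2 <= l < 4]%N else [pred l | 2 <= l < 3]%N)
  (fun v : 'I_n.+1 => if (v < r)%N then [pred l | 2 <= l < 4]%N else [pred l | 1 <= l < 3]%N)
  K _ _ _ _ _ _ _ _ _ _ _)) => //.
- exact: ltW.
- by lra.
- by lra.
- by rewrite card_ord.
- exact: all_weight.
- move=> v _; apply: (le_trans (range_weight _ _ _)).
  by rewrite !big_cons big_nil expr1 z2 z3; lra.
- move=> v; rewrite inE; case: ifP => _; apply: (le_trans (range_weight _ _ _));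
    rewrite !big_cons big_nil z2 ?z3 ler_pdivlMr; lra.
- move=> v; rewrite inE; case: ifP => _; apply: (le_trans (range_weight _ _ _));
    rewrite !big_cons big_nil ?expr1 z2 ?z3; lra.
- move=> k /hK[[k0 ksub] Hd]; exists (tall k (3 * n.+1 + r)), [set v in P | k v <= 1]%N%SET.
  have cap v : v \notin tall k (3 * n.+1 + r) -> (k v <= if v < r then 3 else 2)%N.
    rewrite inE -ltnNge /apery => vH; rewrite leqNgt; apply/negP.
    case: (ltnP v r) => vr k4.
      have : (4 * n.+1 <= k v * n.+1)%N by rewrite leq_mul2r k4 orbT.
      by move: vH rn; move: (k v * n.+1)%N (nat_of_ord v); lia.
    have : (3 * n.+1 <= k v * n.+1)%N by rewrite leq_mul2r k4 orbT.
    by move: vH rn vr; move: (k v * n.+1)%N (nat_of_ord v); lia.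
  split=> //.
  + by apply/fintype.subsetP => v; rewrite inE => /andP[].
  + move=> v /cap kv vP; have vr : (v < r)%N by move: vP; rewrite inE.
    by move: kv; rewrite vr /= k0 ltnS.
  + move=> v /cap kv; rewrite !inE negb_and -leqNgt -ltnNge; case: (ltnP v r) kv => /= vr kv.
      by move=> ->; exact: kv.
    by move=> _; rewrite k0; exact: kv.
  + move=> v a /cap kv; rewrite !inE => /andP[ar ka] Hva.
    have k2 : (2 <= k v)%N.
      have := leq_trans Hva (ksub v a); rewrite /apery => va.
      have ka1 : (k a * n.+1 <= n.+1)%N by rewrite -[leqRHS]mul1n leq_mul2r ka orbT.
      rewrite ltnNge; apply/negP => kv1.
      have kv2 : (k v * n.+1 <= n.+1)%N by rewrite -[leqRHS]mul1n leq_mul2r kv1 orbT.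
      move: va ka1 kv2 ar (ltn_ord v); move: (k v * n.+1)%N (k a * n.+1)%N.
      by move: (nat_of_ord v) (nat_of_ord a); lia.
    by case: (ltnP v r) kv => /= vr kv; rewrite k2; exact: kv.
by rewrite card_ord cP weaken_case//; lra.
Qed.

(** Apart from the [d] residues of [tall k H] and the [s] smallest residues,
[e_v < 3 m], so the label is 1 or 2.  The window has to be long enough to
outweigh the factor 16 on the [s] smallest residues. *)
Lemma matching_case (K : pred {ffun 'I_n.+1 -> 'I_N}) lo p t :
  (s * 16 <= p)%N -> (lo + p <= n.+1)%N ->
  (forall v, (lo <= v < lo + p)%N -> (v.*2 < t)%N /\ (t < v + n.+1)%N) ->
  (forall k, K k -> [/\ kunz k,
     exists2 H, #|tall k H| = d & (H < 3 * n.+1 + s)%N &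
     forall u v : 'I_n.+1, (u + v)%N = t -> (2 < k u + k v)%N]) ->
  \sum_(k | K k) \prod_v z ^+ k v <= case_bound.
Proof.
move=> sp lop ht hK.
have [zl zh z0 z2] := inv_golden_bounds gz; have /andP[g0 g1] := gain_bounds.
have sn : (s <= n.+1)%N by lia.
have cov k : K k -> exists2 Y : {set 'I_n.+1}, (#|Y| <= d)%N &
    (forall v, v \notin Y :|: [set v : 'I_n.+1 | v < s]%N -> (0 < k v <= 2)%N)%SET /\
    (forall u v : 'I_n.+1, (u + v)%N = t -> (2 < k u + k v)%N).
  move=> /hK[[k0 ksub] [H Hd Hs] kt]; exists (tall k H); first by rewrite Hd.
  split=> // v; rewrite !inE negb_or -ltnNge -leqNgt /apery => /andP[vH vs].
  rewrite k0 leqNgt; apply/negP => k3.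
  have : (3 * n.+1 <= k v * n.+1)%N by rewrite leq_mul2r k3 orbT.
  by move: vH Hs vs; move: (k v * n.+1)%N (nat_of_ord v); lia.
have z12 : 1 / 2 <= z by lra.
apply: (le_trans (matching_bound z12 z2 (all_weight N) lop ht cov)).
rewrite card_below// /case_bound expr2 -mulrA.
have S1 : 1 <= (#|small_sets 'I_n.+1 d|%:R : R).
  rewrite ler1n; apply/card_gt0P; exists finset.set0.
  by rewrite inE cards0.
rewrite -[leLHS]mul1r ler_pM ?ler01 ?mulr_ge0 ?exprn_ge0 ?(ltW z0)//.
rewrite ler_wpM2l// exprD -!mulrA ler_wpM2l ?exprn_ge0//.
rewrite -[leLHS]mul1r ler_pM ?ler01 ?mulr_ge0 ?exprn_ge0 ?(ltW z0)//.
  by rewrite exprn_ege1// ler1n.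
apply: (@le_trans _ _ ((16 * z ^+ 16) ^+ s)).
  rewrite exprMn ler_wpM2l ?exprn_ge0// -exprM ler_wiXn2l ?(ltW z0)//; first by lra.
  by rewrite mulnC.
have z8 : z ^+ 8 <= 1 / 20 by move: g0; rewrite /gain; lra.
rewrite lerXn2r ?nnegrE ?mulr_ge0 ?exprn_ge0 ?(ltW z0)//; first by lra.
have : z ^+ 16 <= (1 / 20) ^+ 2.
  rewrite -[16%N]/(8 * 2)%N exprM lerXn2r ?nnegrE ?exprn_ge0 ?(ltW z0)//; lra.
by move: g0; lra.
Qed.

(** The thresholds [H] are split into the four cases.  In the matching case, let
[e_i >= (3 + 1 / T) m]; either [i >= m / T], and the pairs of sum [i] are used, with the window starting at 0;
or [i < m / T], so that [k_i >= 4], and the pairs of sum [m + i] are used, with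
the window starting at [i + 1].  Residues of sum [q m + i] satisfy
[k_u + k_v >= k_i - q]. *)
Lemma kunz_weight_bound (K : pred {ffun 'I_n.+1 -> 'I_N}) T : (1 < T)%N ->
  s = (n.+1 %/ (4 * T) %/ 16)%N -> (d <= n.+1)%N ->
  (forall k, K k -> kunz k /\
     exists i, ((3 * T).+1 * n.+1 <= apery k i * T)%N) ->
  \sum_(k | K k) \prod_v z ^+ k v <= (10 * n.+1)%:R * case_bound.
Proof.
move=> T1 sE dn hK.
have [zl zh z0 z2] := inv_golden_bounds gz; have /andP[g0 g1] := gain_bounds.
pose p := (n.+1 %/ (4 * T))%N.
have pT : (p * (4 * T) <= n.+1)%N by exact: leq_divM.
have sp : (s * 16 <= p)%N by rewrite sE leq_divM.
have p8 : (p * 8 <= n.+1)%N.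
  by rewrite (leq_trans _ pT)// leq_mul2l (_ : 8 <= 4 * T)%N ?orbT//; lia.
pose lo t := if (t < n.+1)%N then 0%N else (t - n)%N.
pose good t := (lo t + p <= n.+1)%N /\
  (forall v, (lo t <= v < lo t + p)%N -> (v.*2 < t)%N /\ (t < v + n.+1)%N).
(* The unit stands for all thresholds H >= 7 m, the first ordinal for H, the
   second one for the sum t of the matched residues. *)
pose J : finType := (unit + 'I_(7 * n.+1) + 'I_(2 * n.+1))%type.
pose C (j : J) (k : {ffun 'I_n.+1 -> 'I_N}) : bool := match j with
  | inl (inl _) => `[< kunz k /\ exists2 H, #|tall k H| = d & (7 * n.+1 <= H)%N >]
  | inl (inr H) => `[< kunz k /\ #|tall k H| = d >]
  | inr t => `[< [/\ kunz k,
     exists2 H, #|tall k H| = d & (H < 3 * n.+1 + s)%N &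
     forall u v : 'I_n.+1, (u + v)%N = t -> (2 < k u + k v)%N] >]
  end.
pose Q (j : J) : bool := match j with
  | inl (inl _) => true
  | inl (inr H) => (3 * n.+1 + s <= H)%N
  | inr t => `[< good t >]
  end.
have cover k : K k -> exists2 j, Q j & C j k.
  move=> /hK[kk [i iT]].
  have [|H Hd] := @exists_tall_of_card n N k d; first by rewrite d0 dn.
  have [H7|H7] := leqP (7 * n.+1) H.
    by exists (inl (inl tt)) => //; apply/asboolP; split=> //; exists H.
  have [H3|H3] := leqP (3 * n.+1 + s) H.
    by exists (inl (inr (Ordinal H7))) => //; apply/asboolP.
  suff [t [t2 gt ht]] : exists t, [/\ (t < 2 * n.+1)%N, good t &
      forall u v : 'I_n.+1, (u + v)%N = t -> (2 < k u + k v)%N].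
    by exists (inr (Ordinal t2)); apply/asboolP => //; split=> //; exists H.
  have [k0 ksub] := kk.
  have kadd (u v : 'I_n.+1) q : (u + v = q * n.+1 + i)%N -> (k i <= k u + k v + q)%N.
    move=> uv; have := ksub u v.
    have -> : (u + v)%R = i by apply/val_inj => /=; rewrite uv modnMDl modn_small.
    rewrite /apery => h; rewrite -(leq_pmul2r (ltn0Sn n)) !mulnDl; move: uv h.
    by move: (k i * _)%N (k u * _)%N (k v * _)%N (q * _)%N; lia.
  have ki q : ((q * n.+1 + i) * T < (3 * T).+1 * n.+1)%N -> (q < k i)%N.
    move=> qi; rewrite ltnNge; apply/negP => kq.
    have := leq_ltn_trans iT; move=> /(_ _ ((leq_ltn_trans _ qi))).
    rewrite /apery leq_mul2r leq_add2r leq_mul2r kq !orbT => /(_ isT).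
    by rewrite ltnn.
  have [iT1|iT1] := leqP n.+1 (i * T).
    have k3 : (2 < k i)%N.
      apply: ki; apply: (@leq_trans (3 * n.+1 * T)%N); last by lia.
      by rewrite ltn_pmul2r; have := ltn_ord i; lia.
    have p4 : (p * 4 <= i)%N.
      by rewrite -(@leq_pmul2r T) ?(leq_trans _ iT1)// -?mulnA//; lia.
    exists i; split.
    - by have := ltn_ord i; lia.
    - rewrite /good /lo ltn_ord; split=> [|v]; first by lia.
      by have := ltn_ord i; move: p4; clear; lia.
    - move=> u v uv; apply: (leq_trans k3).
      by rewrite -[leqRHS]addn0; apply: kadd; rewrite uv mul0n.
  have k4 : (3 < k i)%N by apply: ki; rewrite mulnDl; lia.
  have i2 : (i * 2 < n.+1)%N by apply: leq_ltn_trans iT1; rewrite leq_mul2l T1 orbT.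
  exists (n.+1 + i)%N; split.
  - by have := ltn_ord i; lia.
  - rewrite /good /lo ltnNge leq_addr/= addSn -addnS addKn.
    by move: p8 i2; clear; split=> [|v]; lia.
  - move=> u v uv; rewrite -ltnS (leq_trans k4)//.
    have -> : (k u + k v).+1 = (k u + k v + 1)%N by rewrite addn1.
    by apply: kadd; rewrite uv mul1n.
apply: (le_trans (sum_cover _ cover)) => [k|].
  by apply: prodr_ge0 => v _; rewrite exprn_ge0// ltW.
have cb0 : 0 <= case_bound.
  by rewrite /case_bound !mulr_ge0 ?exprn_ge0//; lra.
apply: (@le_trans _ _ (\sum_(j : J) case_bound)); last first.
  rewrite sumr_const -[leLHS]mulr_natl ler_wpM2r// ler_nat.
  by rewrite !card_sum card_unit !card_ord; lia.
rewrite [leLHS]big_mkcond/=; apply: ler_sum => j _; case: ifPn => // Qj.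
case: j Qj => [[u|H]|t] /= Qj.
- apply: deep_case => [|k /asboolP//]; lia.
- have [H4|H4] := leqP (4 * n.+1) H.
    apply: (@middle_case _ H) => [||k /asboolP//]; [lia|by rewrite H4/=].
  apply: (@shallow_case _ (H - 3 * n.+1)) => [|k /asboolP]; first by lia.
  by rewrite subnKC//; lia.
- have [lop ht] := asboolP _ Qj.
  by apply: (@matching_case _ (lo t) p t) => // k /asboolP.
Qed.

End Golden.

(** * Kunz vectors of numerical semigroups *)

Local Open Scope classical_set_scope.
Local Open Scope ring_scope.

Definition semigroup_of n N (k : {ffun 'I_n.+1 -> 'I_N}) : set nat :=
  [set x | x = 0%N \/ (apery k (inord (x %% n.+1)) <= x)%N].

Definition kunz_of_size n N T g (k : {ffun 'I_n.+1 -> 'I_N}) : Prop :=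
  [/\ kunz k, (\sum_v k v <= g.+1)%N &
      exists i, ((3 * T).+1 * n.+1 <= apery k i * T)%N].

(** For a residue [v], the [k_v] numbers [j m + v] with [j < k_v] are gaps, except
for 0; since they are distinct, the labels sum to at most [g + 1].  A gap [y]
forces the Apery element of its class to be at least [y + m]. *)
Lemma kunz_of_semigroup (S : set nat) g T y :
  numerical_semigroup S -> genus S = g -> ~ S y ->
  ((2 * T).+1 * multiplicity S <= y * T)%N ->
  exists n, (n <= g)%N /\ exists k : {ffun 'I_n.+1 -> 'I_g.+2},
    kunz_of_size T g k /\ S = semigroup_of k.
Proof.
move=> Sns gS Sy yT; have [S0 SD Sfin] := Sns.
have Sbig x : (g.*2 <= x)%N -> S x.
  by move=> gx; apply: contrapT => /(gap_bound Sns); rewrite gS ltnNge gx.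
have [] : (S `\ 0%N) (multiplicity S) /\
    forall x, (S `\ 0%N) x -> (multiplicity S <= x)%N.
  by apply: nat_minP; exists g.*2.+1; split=> //; apply: Sbig.
move: yT; set m := multiplicity S => yT [Sm /eqP m0] mmin.
case: m m0 => [//|n] _ in yT Sm mmin *.
pose E (v : 'I_n.+1) := [set x | [/\ S x, (0 < x)%N & x %% n.+1 = v]%N].
pose e v := nat_min (E v).
have eP v : E v (e v) /\ forall x, E v x -> (e v <= x)%N.
  apply: nat_minP; exists (g.*2.+1 * n.+1 + v)%N; split.
  - by apply: Sbig; rewrite mulSn mulnS; lia.
  - by rewrite mulSn.
  - by rewrite modnMDl modn_small.
have SMD x j : S x -> S (x + j * n.+1)%N.
  by move=> Sx; elim: j => [|j IH]; rewrite ?addn0// mulSn addnCA; exact: SD.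
have edef v : e v = (e v %/ n.+1 * n.+1 + v)%N.
  by have [[_ _ ev] _] := eP v; rewrite {1}(divn_eq (e v) n.+1) ev.
(* The Apery elements determine S. *)
have Sin x : S x <-> x = 0%N \/ (e (inord (x %% n.+1)) <= x)%N.
  set v : 'I_n.+1 := inord _; have xv : (x %% n.+1 = v)%N by rewrite inordK// ltn_pmod.
  have [[Sev ev0 evm] emin] := eP v.
  split=> [Sx|[->//|ex]].
    by have [->|x0] := posnP x; [left|right; apply: emin].
  have -> : x = (e v + (x %/ n.+1 - e v %/ n.+1) * n.+1)%N; last exact: SMD.
  have : (e v %/ n.+1 <= x %/ n.+1)%N by exact: leq_div2r.
  rewrite mulnBl {1}(divn_eq x n.+1) xv {1}(edef v).
  by rewrite -(leq_pmul2r (ltn0Sn n)); lia.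
have ek v : (0 < e v %/ n.+1)%N.
  have [[Sev ev0 _] _] := eP v; rewrite divn_gt0//; apply: mmin; split=> //.
  by move=> /= ev; rewrite ev in ev0.
have sumk : (\sum_v e v %/ n.+1 <= g.+1)%N.
  pose G : seq nat := fset_set (~` S).
  pose s := [seq (j * n.+1 + (v : 'I_n.+1))%N | v <- enum 'I_n.+1, j <- iota 0 (e v %/ n.+1)].
  have -> : (\sum_v e v %/ n.+1 = size s)%N.
    rewrite size_allpairs_dep sumnE big_map big_enum/=.
    by apply: eq_bigr => v _; rewrite size_iota.
  have us : uniq s.
    apply: allpairs_uniq_dep => [||[v j] [w i] _ _ /= eq_vj].
    - exact: enum_uniq.
    - by move=> v _; exact: iota_uniq.
    have vw : v = w.
      apply/val_inj; have := congr1 (modn^~ n.+1) eq_vj.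
      by rewrite /= !modnMDl !modn_small.
    rewrite vw in eq_vj *; move/addIn/eqP: eq_vj; rewrite eqn_pmul2r// => /eqP ->//.
  have sub : {subset s <= 0%N :: G}.
    move=> x /allpairsPdep[v [j [_ jv ->]]]; rewrite inE; case: eqP => //= /eqP x0.
    rewrite /G in_fset_set// inE => Sx; move: jv; rewrite mem_iota/= add0n.
    apply/negP; rewrite -leqNgt.
    have [_ /(_ (j * n.+1 + v)%N)] := eP v.
    have /[swap]/[apply] : E v (j * n.+1 + v)%N.
      by split=> //; rewrite ?lt0n// modnMDl modn_small.
    by rewrite {1}edef leq_add2r leq_pmul2r.
  by have := uniq_leq_size us sub; rewrite /= -gS.
have kb v : (e v %/ n.+1 < g.+2)%N.
  by rewrite ltnS (leq_trans _ sumk)// (bigD1 v)//= leq_addr.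
exists n; split.
  have : (\sum_(v < n.+1) 1 <= g.+1)%N.
    by apply: leq_trans sumk; apply: leq_sum => v _; exact: ek.
  by rewrite sum1_card card_ord.
exists [ffun v => Ordinal (kb v)].
have ap v : apery [ffun v => Ordinal (kb v)] v = e v.
  by rewrite /apery ffunE /= -edef.
split; last first.
  by apply/seteqP; split=> x; rewrite /semigroup_of/= ap => /Sin.
split.
- split=> [v|a b]; first by rewrite ffunE/=; exact: ek.
  rewrite !ap; have [_] := eP (a + b)%R; apply.
  have [[Sa a0 ma] _] := eP a; have [[Sb b0 mb] _] := eP b.
  by split; [exact: SD|rewrite addn_gt0 a0|rewrite -modnDm ma mb].
- by under eq_bigr do rewrite ffunE/=.
- exists (inord (y %% n.+1)); rewrite ap.
  set v : 'I_n.+1 := inord _; have yv : (y %% n.+1 = v)%N by rewrite inordK// ltn_pmod.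
  have ye : (y < e v)%N by rewrite ltnNge; apply/negP => ey; apply: Sy; apply/Sin; right.
  have yme : (y + n.+1 <= e v)%N.
    rewrite (edef v) (divn_eq y n.+1) yv addnAC leq_add2r addnC -mulSn leq_pmul2r//.
    by move: ye; rewrite {1}(edef v) {1}(divn_eq y n.+1) yv ltn_add2r ltn_pmul2r.
  apply: (@leq_trans ((y + n.+1) * T)%N); last by rewrite leq_mul2r yme orbT.
  by rewrite mulnDl; move: yT; lia.
Qed.

Lemma large_frobenius_gap (R : realType) (eps : R) g T (S : set nat) :
  0 < eps -> 1 <= eps * T%:R -> large_frobenius eps g S ->
  exists2 y, ~ S y & ((2 * T).+1 * multiplicity S <= y * T)%N.
Proof.
move=> e0 eT [Sns gS]; rewrite /frobenius.
have [Sc cmin] : (forall x, S (conductor S + x)%N) /\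
    forall c, (forall x, S (c + x)%N) -> (conductor S <= c)%N.
  apply: (@nat_minP [set c | forall x, S (c + x)%N]); exists g.*2 => x /=.
  by apply: contrapT => /(gap_bound Sns); rewrite gS ltnNge leq_addr.
move: (conductor S) Sc cmin => [|y] Sc cmin.
  rewrite sub0r mulrNz ltNge; apply: contraNP => _.
  by rewrite (@le_trans _ _ 0)// ?oppr_le0 ?ler0z// mulr_ge0//; lra.
have -> : y.+1%:Z - 1 = y%:Z by rewrite -addn1 PoszD addrK.
move=> yR; exists y.
  move=> Sy; have := cmin y; rewrite ltnn => h.
  suff : false by []. apply: h => -[|x]; first by rewrite addn0.
  by rewrite addnS -addSn.
rewrite -(ler_nat R) !natrM -addn1 natrD natrM.
have : (2 + eps) * (multiplicity S)%:R * T%:R <= y%:R * T%:R.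
  by rewrite ler_wpM2r// ltW// -[y%:R]/(y%:Z%:~R).
apply: le_trans.
rewrite mulrAC ler_wpM2r//; lra.
Qed.

Lemma count_semigroups_le (R : realType) (eps : R) g T :
  0 < eps -> 1 <= eps * T%:R ->
  (count_semigroups eps g <=
   \sum_(n < g.+1) #|[pred k : {ffun 'I_n.+1 -> 'I_g.+2} | `[< kunz_of_size T g k >]]|)%N.
Proof.
move=> e0 eT.
pose s := [seq [seq semigroup_of k | k <-
  enum [pred k : {ffun 'I_n.+1 -> 'I_g.+2} | `[< kunz_of_size T g k >]]] | n <- iota 0 g.+1].
have -> : (\sum_(n < g.+1) #|[pred k : {ffun 'I_n.+1 -> 'I_g.+2} | `[< kunz_of_size T g k >]]|)%N
    = size (flatten s).
  rewrite size_flatten /shape -map_comp sumnE big_map -[iota _ _]/(index_iota 0 g.+1) big_mkord.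
  by apply: eq_bigr => n _; rewrite /= size_map -cardE.
apply: uniq_leq_size => [|S]; first exact: fset_uniq.
rewrite in_fset_set; last exact: finite_large_frobenius.
rewrite inE => LS; have [y Sy yT] := large_frobenius_gap e0 eT LS.
have [Sns gS _] := LS.
have [n [ng [k [kk Sk]]]] := kunz_of_semigroup Sns gS Sy yT.
apply/flattenP; exists [seq semigroup_of k | k <-
  enum [pred k : {ffun 'I_n.+1 -> 'I_g.+2} | `[< kunz_of_size T g k >]]].
  by apply/mapP; exists n => //; rewrite mem_iota.
by apply/mapP; exists k => //; rewrite mem_enum; apply/asboolP.
Qed.

(** * Exponential estimates *)

Lemma bernoulli (R : realDomainType) (t : R) n : -1 <= t ->
  1 + n%:R * t <= (1 + t) ^+ n.
Proof.
move=> t1; elim: n => [|n IH]; first by rewrite mul0r addr0 expr0.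
rewrite exprSr; apply: (@le_trans _ _ ((1 + n%:R * t) * (1 + t))).
  have : 0 <= n%:R * (t * t) by rewrite mulr_ge0// -expr2 sqr_ge0.
  by rewrite -natr1; lra.
by rewrite ler_wpM2r//; lra.
Qed.

Lemma exprn_unbounded (R : realType) (a c : R) : 1 < a ->
  exists2 n : nat, (0 < n)%N & c <= a ^+ n.
Proof.
move=> a1; exists (Num.bound `|c / (a - 1)|).+1 => //.
set n := Num.bound _.
have cn : c / (a - 1) <= n.+1%:R.
  by rewrite (le_trans (ler_norm _))// (le_trans (ltW (archi_boundP (normr_ge0 _))))// ler_nat.
have : 1 + n.+1%:R * (a - 1) <= (1 + (a - 1)) ^+ n.+1 by apply: bernoulli; lra.
rewrite [1 + (a - 1)]addrC subrK; apply: le_trans.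
by move: cn; rewrite ler_pdivrMr; lra.
Qed.

(** With [t = (1 - c) / Q], the Bernoulli inequality gives [c <= (1 - t) ^+ Q], and
[(1 - t) * (1 + t) <= 1]. *)
Lemma small_root (R : realFieldType) (c : R) Q : 0 < c < 1 -> (0 < Q)%N ->
  exists a : R, [/\ 1 < a, a <= 2 & c * a ^+ Q <= 1].
Proof.
move=> /andP[c0 c1] Q0; pose t := (1 - c) / Q%:R.
have Qt : Q%:R * t = 1 - c by rewrite /t mulrC divfK// pnatr_eq0 -lt0n.
have Q1 : 1 <= (Q%:R : R) by rewrite ler1n.
have t0 : 0 < t by rewrite divr_gt0//; lra.
have t1 : t <= 1 by rewrite /t ler_pdivrMr; lra.
exists (1 + t); split; [lra|lra|].
have cb : c <= (1 - t) ^+ Q.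
  have : 1 + Q%:R * (- t) <= (1 + (- t)) ^+ Q by apply: bernoulli; lra.
  by rewrite mulrN Qt; lra.
apply: (@le_trans _ _ ((1 - t) ^+ Q * (1 + t) ^+ Q)).
  by rewrite ler_wpM2r// exprn_ge0//; lra.
rewrite -exprMn exprn_ile1//; first by rewrite mulr_ge0; lra.
by rewrite -subr_sqr expr1n; have := sqr_ge0 t; lra.
Qed.

Lemma exp_dominates_square (R : realType) (a : R) : 1 < a ->
  exists M : nat, forall g, (M <= g)%N -> 20 * (g.+1%:R) ^+ 2 <= a ^+ g.
Proof.
move=> a1; pose r := Num.sqrt (Num.sqrt a).
have r4 : r ^+ 4 = a.
  by rewrite /r -[4%N]/(2 * 2)%N exprM !sqr_sqrtr ?sqrtr_ge0//; lra.
have r0 : 0 <= r by rewrite sqrtr_ge0.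
have r1 : 1 < r by rewrite ltNge; apply/negP => r1; have := exprn_ile1 4 r0 r1; rewrite r4; lra.
pose u := r - 1; have u0 : 0 < u by rewrite /u; lra.
exists (Num.bound `|9 / (u * u)|).+1 => g Mg.
have uu : 0 < u * u by rewrite mulr_gt0.
have g9 : 9 <= g%:R * (u * u).
  rewrite -ler_pdivrMr// (le_trans (ler_norm _))//.
  by rewrite (le_trans (ltW (archi_boundP (normr_ge0 _))))// ler_nat ltnW.
have g1 : 1 <= g%:R :> R by rewrite ler1n; lia.
have gu : g%:R * u <= r ^+ g.
  have : 1 + g%:R * u <= (1 + u) ^+ g by apply: bernoulli; lra.
  by rewrite /u [1 + (r - 1)]addrC subrK; lra.
have g2 : (g%:R * u) ^+ 4 <= a ^+ g.
  by rewrite -r4 exprAC lerXn2r ?nnegrE ?exprn_ge0// mulr_ge0//; lra.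
apply: le_trans g2.
have -> : (g%:R * u) ^+ 4 = (g%:R * (u * u)) ^+ 2 * g%:R ^+ 2 by ring.
apply: (@le_trans _ _ (9 ^+ 2 * g%:R ^+ 2)).
  by rewrite -natr1; nra.
by rewrite ler_wpM2r ?exprn_ge0// lerXn2r ?nnegrE ?mulr_ge0//; lra.
Qed.

Definition inv_phi (R : realType) : R := (Num.sqrt 5 - 1) / 2.

Lemma inv_phi_golden (R : realType) : inv_golden (inv_phi R).
Proof.
have s5 : Num.sqrt 5 ^+ 2 = 5 :> R by rewrite sqr_sqrtr; lra.
have s1 : 1 < Num.sqrt 5 :> R.
  rewrite ltNge; apply/negP => h; have := exprn_ile1 2 (sqrtr_ge0 5) h.
  by rewrite s5; lra.
split; rewrite /inv_phi; first by lra.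
have -> : ((Num.sqrt 5 - 1) / 2) ^+ 2 = (Num.sqrt 5 ^+ 2 - 2 * Num.sqrt 5 + 1) / 4 :> R.
  by field.
by rewrite s5; lra.
Qed.

Lemma golden_ratioE (R : realType) : golden_ratio R = 1 + inv_phi R.
Proof. by rewrite /golden_ratio /inv_phi; lra. Qed.

Lemma card_kunz_le (R : realFieldType) (w : R) n g T : 0 < w <= 1 ->
  #|[pred k : {ffun 'I_n.+1 -> 'I_g.+2} | `[< kunz_of_size T g k >]]|%:R * w ^+ g.+1 <=
  \sum_(k : {ffun 'I_n.+1 -> 'I_g.+2} | `[< kunz_of_size T g k >]) \prod_v w ^+ k v.
Proof.
move=> /andP[w0 w1]; rewrite mulr_natl -sumr_const; apply: ler_sum => k.
move=> /asboolP[_ kg _]; rewrite prodrXr ler_wiXn2l//; exact: ltW.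
Qed.

(** The number of compositions of at most [g + 1] into [m] positive parts, by the
weight 2 / 3, for which all positive labels together weigh 2.  It is useful when
[m] is small compared with [g], as 3 / 2 is less than the golden ratio. *)
Lemma card_kunz_crude (R : realFieldType) n g T :
  #|[pred k : {ffun 'I_n.+1 -> 'I_g.+2} | `[< kunz_of_size T g k >]]|%:R <=
  (3 / 2) ^+ g.+1 * 2 ^+ n.+1 :> R.
Proof.
have w01 : 0 < (2 / 3 : R) <= 1 by apply/andP; split; lra.
(* The second summand is the missing label 0, absent from an empty range. *)
have wt N : box_weight (2 / 3 : R) N [pred l | 0 < l]%N + (0 < N)%N%:R
    <= 3 * (1 - (2 / 3) ^+ N).
  elim: N => [|[_|N IH]].
  - by rewrite /box_weight big_ord0 expr0 subrr mulr0 addr0.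
  - by rewrite /box_weight big_mkcond big_ord_recr big_ord0/= expr1; lra.
  - move: IH; rewrite /box_weight [in X in _ -> X]big_mkcond big_ord_recr/= -big_mkcond/=.
    by set S := \sum_(_ < N.+1 | _) _; rewrite [_ ^+ N.+2]exprS; lra.
have cov (k : {ffun 'I_n.+1 -> 'I_g.+2}) : `[< kunz_of_size T g k >] ->
    exists2 t : unit, true & forall v, [pred l | 0 < l]%N (k v).
  by move=> /asboolP[[k0 _] _ _]; exists tt.
have w0 : 0 <= (2 / 3 : R) by lra.
have /le_trans := card_kunz_le n g T w01.
move=> /(_ _ (box_cover (B := fun _ _ => [pred l | 0 < l]%N) w0 cov)).
rewrite big_const card_unit /= addr0 prodr_const card_ord => h.
rewrite -[(3 / 2) ^+ _]invrK -exprVn (_ : (3 / 2)^-1 = 2 / 3); last by field.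
have wg : 0 < (2 / 3 : R) ^+ g.+1 by rewrite exprn_gt0//; lra.
rewrite mulrC ler_pdivlMr//.
apply: (le_trans h); rewrite lerXn2r ?nnegrE ?box_weight_ge0//.
have := wt g.+2; have : 0 <= (2 / 3 : R) ^+ g.+2 by rewrite exprn_ge0.
rewrite /=; lra.
Qed.

(** The gain [gain z ^+ s] is at most [a ^+ - (46 m)] for some [a > 1] that does
not depend on [d] and [L].  These are then chosen, [d] as a small fraction of
[m] and [L] large, to make each of the losses at most a small power of [a ^+ m];
the two families of small sets and the two other factors cost [a ^+ (6 m)].
The condition [L.+1 * m <= d * d], true for large [m], ensures that fingerprints
have at most [d] elements. *)
Lemma case_bound_decay (R : realType) (z : R) T : inv_golden z -> (1 < T)%N ->
  exists2 a : R, 1 < a & exists M, forall n, (M <= n.+1)%N ->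
  exists d L, [/\ (0 < L)%N, (0 < d <= n.+1)%N, (L.+1 * n.+1 <= d * d)%N &
    case_bound z n d L (n.+1 %/ (4 * T) %/ 16) * a ^+ (40 * n.+1) <= 1].
Proof.
move=> gz T1; have /andP[g0 g1] := gain_bounds gz.
have gpos : 0 < gain z < 1 by apply/andP; split; lra.
have [|a [a1 a2 ga]] := small_root (Q := 46 * (128 * T)) gpos; first by lia.
exists a => //.
have a0 : 0 < a by lra.
have [L L0 aL] := exprn_unbounded 2 a1.
have [D1 D10 aD1] := exprn_unbounded 16 a1.
have [D2 D20 aD2] := exprn_unbounded (a - 1)^-1 a1.
pose D := maxn D1 D2.
have D0 : (0 < D)%N by rewrite leq_max D10.
have monoD E : (E <= D)%N -> a ^+ E <= a ^+ D by move=> ED; rewrite ler_weXn2l// ltW.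
have aD16 : 16 <= a ^+ D by rewrite (le_trans aD1)// monoD// leq_maxl.
have aDinv : (a - 1)^-1 <= a ^+ D by rewrite (le_trans aD2)// monoD// leq_maxr.
exists (128 * T + D + L.+1 * (2 * D) ^ 2)%N => n; set m := n.+1 => Mm.
have [M1 M2 M3] : [/\ 128 * T <= m, D <= m & L.+1 * (2 * D) ^ 2 <= m]%N.
  move: Mm; move: (128 * T)%N (L.+1 * _)%N m => x y m'; clear; split; lia.
clear Mm.
pose d := (m %/ D)%N; pose s := (m %/ (4 * T) %/ 16)%N.
have dD : (d * D <= m)%N by exact: leq_divM.
have d0 : (0 < d)%N by rewrite divn_gt0.
have d2D : (m <= d * (2 * D))%N.
  have : (m < d.+1 * D)%N by rewrite -ltn_divLR.
  have : (D <= d * D)%N by rewrite leq_pmull.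
  rewrite mulSn mulnCA mul2n -addnn; move: (d * D)%N; clear; lia.
have s128 : (m <= s * (128 * T))%N.
  rewrite /s -divnMA; set Q := (4 * T * 16)%N.
  have TQ : (128 * T = 2 * Q)%N by rewrite /Q; clear; lia.
  have Q0 : (0 < Q)%N by rewrite /Q !muln_gt0 (ltnW T1).
  have : (m < (m %/ Q).+1 * Q)%N by rewrite -ltn_divLR.
  have : (Q <= m %/ Q * Q)%N.
    by rewrite leq_pmull// divn_gt0//; move: M1; rewrite TQ; clear; lia.
  rewrite mulSn TQ mulnCA mul2n -addnn; move: (_ %/ _ * _)%N; clear; lia.
exists d, L; split => //.
- by rewrite d0 leq_div.
- have m0 : (0 < m)%N by [].
  rewrite -(@leq_pmul2r ((2 * D) ^ 2)); last by rewrite expn_gt0 muln_gt0 D0.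
  have -> : (d * d * (2 * D) ^ 2 = (d * (2 * D)) * (d * (2 * D)))%N by rewrite -mulnn mulnACA.
  by rewrite mulnAC (leq_trans _ (leq_mul d2D d2D))// leq_mul2r M3 orbT.
have am1 : 0 < a - 1 <= 1 by apply/andP; split; lra.
have S2 : (#|small_sets 'I_m d|%:R : R) <= a ^+ (2 * m).
  apply: (le_trans (card_small_sets _ _ am1)); rewrite card_ord.
  rewrite [1 + _]addrC subrK mul2n -addnn exprD ler_wpM2r ?exprn_ge0 ?(ltW a0)//.
  rewrite -exprVn (@le_trans _ _ ((a ^+ D) ^+ d))//.
    by rewrite lerXn2r ?nnegrE ?invr_ge0 ?exprn_ge0 ?(ltW a0)//; lra.
  by rewrite -exprM mulnC ler_weXn2l// ltW.
have d16 : (16 ^+ d : R) <= a ^+ m.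
  rewrite (@le_trans _ _ ((a ^+ D) ^+ d))//.
    by rewrite lerXn2r ?nnegrE ?exprn_ge0 ?(ltW a0).
  by rewrite -exprM mulnC ler_weXn2l// ltW.
have L2 : (2 ^+ (m %/ L) : R) <= a ^+ m.
  rewrite (@le_trans _ _ ((a ^+ L) ^+ (m %/ L)))//.
    by rewrite lerXn2r ?nnegrE ?exprn_ge0 ?(ltW a0).
  by rewrite -exprM mulnC ler_weXn2l ?leq_divM// ltW.
have gs : gain z ^+ s * a ^+ (46 * m) <= 1.
  apply: (@le_trans _ _ ((gain z * a ^+ (46 * (128 * T))) ^+ s)).
    rewrite exprMn ler_wpM2l ?exprn_ge0//; first by lra.
    rewrite -exprM ler_weXn2l ?(ltW a1)// -mulnA leq_mul2l /=.
    by rewrite mulnC.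
  by rewrite exprn_ile1// mulr_ge0 ?exprn_ge0//; lra.
apply: le_trans gs; rewrite /case_bound -/m -/s.
rewrite (_ : 46 * m = 2 * m + 2 * m + m + m + 40 * m)%N; last by clear; lia.
rewrite [a ^+ (_ + 40 * m)]exprD [leRHS]mulrA ler_wpM2r ?exprn_ge0 ?(ltW a0)//.
rewrite [leLHS]mulrA [leRHS]mulrC ler_wpM2r ?exprn_ge0//; first by lra.
rewrite -addnA exprD ler_pM ?mulr_ge0 ?exprn_ge0//.
  by rewrite expr2 exprD ler_pM.
by rewrite exprD ler_pM ?exprn_ge0.
Qed.

Lemma card_kunz_fine (R : realType) T : (1 < T)%N ->
  exists2 a : R, 1 < a & exists M, forall n g, (M <= n.+1)%N ->
  #|[pred k : {ffun 'I_n.+1 -> 'I_g.+2} | `[< kunz_of_size T g k >]]|%:R *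
    a ^+ (40 * n.+1) <= (1 + inv_phi R) ^+ g.+1 * (10 * n.+1)%:R.
Proof.
move=> T1; have gz := inv_phi_golden R; set z := inv_phi R in gz *.
have [zl zh z0 z2] := inv_golden_bounds gz.
have [a a1 [M hM]] := case_bound_decay gz T1.
exists a => //; exists M => n g /hM[d [L [L0 /andP[d0 dn] Ld cb]]].
have z01 : 0 < z <= 1 by rewrite z0/=; lra.
have := card_kunz_le n g T z01; set K := #|_|%:R => leK.
have := @kunz_weight_bound R z gz n g.+2 d L _ L0 d0 Ld
  (fun k => `[< kunz_of_size T g k >]) T T1 erefl dn.
move=> /(_ _)/(le_trans leK) {}leK.
have zz : (1 + z) * z = 1 by rewrite mulrDl mul1r -expr2 z2; lra.
have -> : K = (1 + z) ^+ g.+1 * (K * z ^+ g.+1).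
  by rewrite mulrCA -exprMn zz expr1n mulr1.
have a0 : 0 < a by lra.
rewrite -mulrA ler_wpM2l ?exprn_ge0//; first by lra.
apply: (@le_trans _ _ ((10 * n.+1)%:R * case_bound z n d L (n.+1 %/ (4 * T) %/ 16) * a ^+ (40 * n.+1))).
  rewrite ler_wpM2r ?exprn_ge0 ?(ltW a0)//; apply: leK.
  by move=> k /asboolP[].
by rewrite -mulrA ler_piMr.
Qed.

(** Multiplicities [m >= g / 20] contribute at most [(phi / a ^+ 2) ^+ g] by
[card_kunz_fine], the others at most [(39 / 25) ^+ g] by [card_kunz_crude], both
up to polynomial factors; here [39 / 25 = 3 / 2 * (26 / 25)] and
[(26 / 25) ^+ 20 >= 2]. *)
Lemma count_semigroups_growth (R : realType) (eps : R) : 0 < eps ->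
  exists2 theta : R, 0 <= theta < golden_ratio R &
  exists M, forall g, (M <= g)%N -> (count_semigroups eps g)%:R <= theta ^+ g.
Proof.
move=> e0; have gz := inv_phi_golden R; rewrite golden_ratioE.
set phi := 1 + inv_phi R.
have [zl zh z0 z2] := inv_golden_bounds gz.
have [T T1 eT] : exists2 T, (1 < T)%N & 1 <= eps * T%:R.
  exists (Num.bound `|eps^-1|).+2 => //; rewrite mulrC -ler_pdivrMr// div1r.
  rewrite (le_trans (ler_norm _))// (le_trans (ltW (archi_boundP (normr_ge0 _))))//.
  by rewrite ler_nat leqW.
have [a a1 [M hM]] := card_kunz_fine R T1.
have a0 : 0 < a by lra.
have a2 : 0 < a ^+ 2 by rewrite exprn_gt0.
pose th0 := Num.max (phi / a ^+ 2) (39 / 25).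
have th0lt : th0 < phi.
  rewrite /th0 gt_max; apply/andP; split; last by rewrite /phi; lra.
  by rewrite ltr_pdivrMr// ltr_pMr ?exprn_egt1// /phi; lra.
have th0gt : 39 / 25 <= th0 by rewrite le_max lexx orbT.
pose th := (th0 + phi) / 2.
exists th; first by rewrite /th /phi in th0lt *; lra.
have r1 : 1 < th / th0 by rewrite ltr_pdivlMr; rewrite /th; lra.
have [M2 hM2] := exp_dominates_square r1.
exists (M2 + 20 * M.+1)%N => g Mg.
have [M2g Mg20] : (M2 <= g)%N /\ (20 * M.+1 <= g)%N.
  by move: Mg; clear; lia.
have := count_semigroups_le g e0 eT; rewrite -(ler_nat R) => /le_trans; apply.
rewrite natr_sum.
have th00 : 0 < th0 by lra.
apply: (@le_trans _ _ (20 * g.+1%:R ^+ 2 * th0 ^+ g)); last first.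
  apply: (@le_trans _ _ ((th / th0) ^+ g * th0 ^+ g)).
    by rewrite ler_wpM2r ?hM2// exprn_ge0// ltW.
  by rewrite -exprMn divfK// gt_eqF.
apply: (@le_trans _ _ (\sum_(n < g.+1) 20 * g.+1%:R * th0 ^+ g)); last first.
  by rewrite sumr_const card_ord -[leLHS]mulr_natl expr2 !mulrA [_ * 20]mulrC.
apply: ler_sum => -[n ng] _ /=.
have g1 : 1 <= (g.+1%:R : R) by rewrite ler1n.
have [gn|ng20] := leqP g (20 * n.+1).
  have /(hM _ g) fine : (M <= n.+1)%N by move: gn Mg20; clear; lia.
  have crude : (1 + inv_phi R) ^+ g.+1 * (10 * n.+1)%:R <= 20 * g.+1%:R * phi ^+ g.
    have ng1 : n.+1%:R <= (g.+1%:R : R) by rewrite ler_nat.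
    rewrite -/phi exprS mulrAC ler_wpM2r ?exprn_ge0//; first by rewrite /phi; lra.
    apply: (@le_trans _ _ (2 * (10 * g.+1%:R))); last by lra.
    by rewrite natrM ler_pM ?mulr_ge0//; rewrite /phi; lra.
  have phE : phi ^+ g = (phi / a ^+ 2) ^+ g * a ^+ (2 * g).
    by rewrite exprM -exprMn divfK// gt_eqF.
  have := le_trans fine crude; rewrite phE mulrA => fine2.
  have : #|[pred k : {ffun 'I_n.+1 -> 'I_g.+2} | `[< kunz_of_size T g k >]]|%:R *
      a ^+ (2 * g) <= 20 * g.+1%:R * (phi / a ^+ 2) ^+ g * a ^+ (2 * g).
    apply: le_trans fine2; rewrite ler_wpM2l// ler_weXn2l ?(ltW a1)//.
    by move: gn; clear; lia.
  rewrite ler_pM2r ?exprn_gt0// => /le_trans; apply.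
  rewrite ler_wpM2l ?mulr_ge0// lerXn2r ?nnegrE//; last by rewrite le_max lexx.
  - by rewrite divr_ge0 ?ltW// /phi; lra.
  - exact: ltW.
apply: (le_trans (card_kunz_crude _ n g T)).
have b20 : 2 <= (26 / 25 : R) ^+ 20.
  rewrite -[20%N]/(5 * 4)%N exprM (@le_trans _ _ ((6 / 5) ^+ 4))//; first by lra.
  have b5 : 6 / 5 <= (26 / 25 : R) ^+ 5.
    have -> : (26 / 25 : R) = 1 + 1 / 25 by lra.
    by apply: le_trans (bernoulli 5 _); lra.
  have c1 : 0 <= (6 / 5 : R) by lra.
  by rewrite lerXn2r ?nnegrE// (le_trans c1 b5).
have b26 : 2 ^+ n.+1 <= (26 / 25 : R) ^+ g.
  apply: (@le_trans _ _ (((26 / 25) ^+ 20) ^+ n.+1)).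
    by rewrite lerXn2r ?nnegrE ?exprn_ge0//; lra.
  by rewrite -exprM ler_weXn2l ?(ltnW ng20)//; lra.
apply: (@le_trans _ _ ((3 / 2) ^+ g.+1 * (26 / 25) ^+ g)).
  by rewrite ler_wpM2l// exprn_ge0//; lra.
rewrite exprS -mulrA -exprMn (_ : 3 / 2 * (26 / 25) = 39 / 25); last by lra.
have c0 : 0 <= (39 / 25 : R) by lra.
have c1 : 3 / 2 <= 20 * (g.+1%:R : R) by lra.
by apply: ler_pM; rewrite ?exprn_ge0// lerXn2r ?nnegrE// ltW.
Qed.

Lemma limn_esup_le_eventually (R : realType) (u : nat -> \bar R) (l : \bar R) M :
  (forall n, (M <= n)%N -> (u n <= l)%E) -> (limn_esup u <= l)%E.
Proof.
move=> ul; rewrite limn_esup_lim; apply: lime_le; first exact: is_cvg_esups.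
near=> n; apply: ge_ereal_sup => _ [m /= nm <-]; apply: ul.
by apply: leq_trans nm; near: n; exact: nbhs_infty_ge.
Unshelve. all: by end_near. Qed.

Theorem theorem1p7 (R : realType) (eps : R) (heps : 0 < eps < 1) :
  (limn_esup (fun g : nat =>
     (((count_semigroups eps g)%:R : R) `^ (g%:R^-1))%:E)
   < (golden_ratio R)%:E)%E.
Proof.
have /andP[e0 _] := heps.
have [th /andP[th0 thlt] [M hM]] := count_semigroups_growth e0.
apply: (@le_lt_trans _ _ th%:E); last by rewrite lte_fin.
apply: (@limn_esup_le_eventually _ _ _ M.+1) => g Mg; rewrite lee_fin.
have g0 : (g%:R : R) != 0 by rewrite pnatr_eq0 -lt0n (leq_trans _ Mg).
have thE : (th ^+ g) `^ g%:R^-1 = th by rewrite -powR_mulrn// -powRrM divff// powRr1.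
rewrite -[leRHS]thE.
apply: ge0_ler_powR; rewrite ?nnegrE ?exprn_ge0 ?invr_ge0//.
by apply: hM; exact: ltnW.
Qed.
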